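(* In $\mathbf{ZF}$, the following are equivalent: (1) $\mathbf{PS}_0$; (2) $\mathbf{PS}_0(\mathbf{I})$; (3) $\mathbf{CUC}\wedge\mathbf{PS}_0(\mathbf{II})$; (4) $\mathbf{CUC}\wedge\mathbf{PS}_0(\mathbf{C})$.
   Context: The background theory is $\mathbf{ZF}$ (no axiom of choice). A set is denumerable if equipotent to $\omega$, countable if it injects into $\omega$, uncountable otherwise. $[X]^{<\omega}$, $[X]^{\leq\omega}$ are the sets of finite, respectively countable, subsets of $X$. For an infinite set $X$, $\mathbf{S}(X,[X]^{\leq\omega})$ is the set $[X]^{<\omega}$ with the topology consisting of all $V\subseteq[X]^{<\omega}$ such that for every $x\in V$ there is $z\in[X]^{\leq\omega}$ with $x\cap z=\emptyset$ and $\{y\in[X]^{<\omega}:x\subseteq y\subseteq X\setminus z\}\subseteq V$. A $P$-space is a topological space in which every $G_\delta$-set (countable intersection of open sets) is open. $\mathbf{CUC}$: countable unions of countable sets are countable. $\mathbf{PS}_0$: for every uncountable set $X$, $\mathbf{S}(X,[X]^{\leq\omega})$ is a $P$-space. $\mathbf{PS}_0(\mathbf{I})$ (respectively, $\mathbf{PS}_0(\mathbf{II})$): if $X$ is any uncountable set and $\{A_n:n\in\omega\}$ is a denumerable family such that (a) for every $n\in\omega$, $\emptyset\neq A_n\subseteq[X]^{<\omega}\setminus\{\emptyset\}$, and (b) for every $n\in\omega$, the set $C_n=\{x\in[X]^{\leq\omega}:(\forall z\in A_n)\ x\cap z\neq\emptyset\}$ is non-empty, then $\bigcap_{n\in\omega}C_n\neq\emptyset$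 (respectively, the family $\{C_n:n\in\omega\}$ has a choice function). $\mathbf{PS}_0(\mathbf{C})$: if $X$ is any uncountable set and $\{A_n:n\in\omega\}$ is a denumerable family such that (c) for every $n\in\omega$, $A_n$ is an uncountable subfamily of $[X]^{<\omega}\setminus\{\emptyset\}$, and (d) for every $n\in\omega$, the family $B_n$ of all countable partitions $\mathcal{Z}$ of $A_n$ such that $(\forall Z\in\mathcal{Z})(\exists x\in[\bigcup Z]^{<\omega})(\forall z\in Z)(x\cap z\neq\emptyset)$ is non-empty, then $\{B_n:n\in\omega\}$ has a choice function. *)

(* Defs.v *)
(* Plain Rocq, no library beyond the prelude.

   "In ZF, ..." is read as "in every model of ZF".  A model is a type with a
   membership relation satisfying the first-order axioms of ZF.  The Separation
   and Replacement schemata range over (codes of) first-order formulas with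
   parameters, and not over arbitrary predicates [M -> Prop]: with arbitrary
   predicates, choice principles of the metatheory would leak into the model.

   All set-theoretic notions below are internal to the model: they unfold to
   first-order formulas in the membership relation, every quantifier ranging
   over elements of the model. *)

Set Implicit Arguments.

Structure set_structure := SetStructure {
  carrier :> Type;
  mem : carrier -> carrier -> Prop
}.
Arguments mem {s} _ _.

Notation "x ∈ y" := (mem x y) (at level 70, no associativity).

(* De Bruijn indices: [f_all] and [f_ex] bind index 0. *)
Inductive formula : Set :=
  | f_mem (i j : nat)
  | f_eq (i j : nat)
  | f_bot
  | f_imp (p q : formula)
  | f_and (p q : formula)
  | f_or (p q : formula)
  | f_all (p : formula)
  | f_ex (p : formula).

Definition scons {T : Type} (x : T) (e : nat -> T) (n : nat) : T :=
  match n with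
  | 0 => x
  | S k => e k
  end.

Fixpoint sat (M : set_structure) (e : nat -> M) (p : formula) : Prop :=
  match p with
  | f_mem i j => e i ∈ e j
  | f_eq i j => e i = e j
  | f_bot => False
  | f_imp p q => sat M e p -> sat M e q
  | f_and p q => sat M e p /\ sat M e q
  | f_or p q => sat M e p \/ sat M e q
  | f_all p => forall x : M, sat M (scons x e) p
  | f_ex p => exists x : M, sat M (scons x e) p
  end.

(* [A ≐ {{ x | P }}] : the set [A] of the model is the class of all [x] with [P]. *)
Definition is_set_of {M : set_structure} (A : M) (P : M -> Prop) : Prop :=
  forall x : M, x ∈ A <-> P x.

Notation "A ≐ {{ x | P }}" := (is_set_of A (fun x => P))
  (at level 70, x name, P at level 200).

Section Basic.
Context {M : set_structure}.
Implicit Types x y z s t A B F : M.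

Definition subset A B : Prop := forall t, t ∈ A -> t ∈ B.
Definition nonempty A : Prop := exists t, t ∈ A.
Definition meets A B : Prop := exists t, t ∈ A /\ t ∈ B.
Definition disjoint A B : Prop := ~ meets A B.

Definition is_empty A : Prop := A ≐ {{ t | False }}.
Definition is_upair A x y : Prop := A ≐ {{ t | t = x \/ t = y }}.
Definition is_union A F : Prop := A ≐ {{ t | exists B, B ∈ F /\ t ∈ B }}.
Definition is_succ s x : Prop := s ≐ {{ t | t ∈ x \/ t = x }}.

Definition inductive A : Prop :=
  (exists o, is_empty o /\ o ∈ A) /\
  (forall x, x ∈ A -> exists s, is_succ s x /\ s ∈ A).

End Basic.

Notation "A ⊆ B" := (subset A B) (at level 70, no associativity).

Record ZF (M : set_structure) : Prop := {
  zf_extensionality :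
    forall x y : M, (forall z : M, z ∈ x <-> z ∈ y) -> x = y;
  zf_foundation :
    forall x : M, nonempty x -> exists y : M, y ∈ x /\ disjoint y x;
  zf_pairing :
    forall x y : M, exists z : M, is_upair z x y;
  zf_union :
    forall F : M, exists U : M, is_union U F;
  zf_power :
    forall x : M, exists P : M, P ≐ {{ y | y ⊆ x }};
  zf_infinity :
    exists w : M, inductive w;
  zf_separation :
    forall (p : formula) (e : nat -> M) (A : M),
      exists B : M, B ≐ {{ x | x ∈ A /\ sat M (scons x e) p }};
  zf_replacement :
    forall (p : formula) (e : nat -> M) (A : M),
      (forall x y y' : M, x ∈ A ->
         sat M (scons x (scons y e)) p -> sat M (scons x (scons y' e)) p ->
         y = y') ->
      exists B : M,
        B ≐ {{ y | exists x : M, x ∈ A /\ sat M (scons x (scons y e)) p }}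
}.

Section Notions.
Context {M : set_structure}.

(* Kuratowski: p = {{x}, {x, y}}. *)
Definition is_opair (p x y : M) : Prop :=
  exists a b : M, is_upair a x x /\ is_upair b x y /\ is_upair p a b.

(* f(x) = y *)
Definition maps (f x y : M) : Prop := exists p : M, is_opair p x y /\ p ∈ f.

Definition function_on (f D : M) : Prop :=
  (forall p : M, p ∈ f -> exists x y : M, x ∈ D /\ is_opair p x y) /\
  (forall x : M, x ∈ D -> exists! y : M, maps f x y).

Definition is_range (R f : M) : Prop := R ≐ {{ y | exists x : M, maps f x y }}.

Definition injection (f A B : M) : Prop :=
  function_on f A /\
  (forall x y : M, maps f x y -> y ∈ B) /\
  (forall x x' y : M, maps f x y -> maps f x' y -> x = x').

Definition bijection (f A B : M) : Prop := injection f A B /\ is_range B f.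

Definition equipotent (A B : M) : Prop := exists f : M, bijection f A B.

Definition is_omega (w : M) : Prop :=
  inductive w /\ forall v : M, inductive v -> w ⊆ v.

Definition finite (A : M) : Prop :=
  exists w n : M, is_omega w /\ n ∈ w /\ equipotent A n.

Definition denumerable (A : M) : Prop :=
  exists w : M, is_omega w /\ equipotent A w.

Definition countable (A : M) : Prop :=
  exists w f : M, is_omega w /\ injection f A w.

Definition uncountable (A : M) : Prop := ~ countable A.

(* x ∈ [X]^{<ω} and x ∈ [X]^{≤ω} *)
Definition finite_subset (x X : M) : Prop := x ⊆ X /\ finite x.
Definition countable_subset (x X : M) : Prop := x ⊆ X /\ countable x.

Definition topology (S T : M) : Prop :=
  (forall U : M, U ∈ T -> U ⊆ S) /\
  (forall U : M, is_empty U -> U ∈ T) /\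
  S ∈ T /\
  (forall U V W : M, U ∈ T -> V ∈ T ->
     W ≐ {{ x | x ∈ U /\ x ∈ V }} -> W ∈ T) /\
  (forall F U : M, F ⊆ T -> is_union U F -> U ∈ T).

(* The intersection of the empty family is the whole space S. *)
Definition G_delta (S T G : M) : Prop :=
  exists F : M, countable F /\ F ⊆ T /\
    G ≐ {{ x | x ∈ S /\ forall U : M, U ∈ F -> x ∈ U }}.

Definition P_space (S T : M) : Prop :=
  topology S T /\ forall G : M, G_delta S T G -> G ∈ T.

(* (S, T) is the space S(X, [X]^{≤ω}). *)
Definition is_space_S (X S T : M) : Prop :=
  S ≐ {{ x | finite_subset x X }} /\
  T ≐ {{ V | V ⊆ S /\
    forall x : M, x ∈ V ->
      exists z : M, countable_subset z X /\ disjoint x z /\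
        forall y : M, finite_subset y X -> x ⊆ y ->
          (forall t : M, t ∈ y -> t ∈ X /\ ~ t ∈ z) -> y ∈ V }}.

Definition partition (Z A : M) : Prop :=
  (forall P : M, P ∈ Z -> nonempty P /\ P ⊆ A) /\
  (forall P Q : M, P ∈ Z -> Q ∈ Z -> P <> Q -> disjoint P Q) /\
  (forall a : M, a ∈ A -> exists P : M, P ∈ Z /\ a ∈ P).

(* f is a choice function of the family F. *)
Definition choice_function (f F : M) : Prop :=
  function_on f F /\ forall c y : M, maps f c y -> y ∈ c.

(* A is a function with domain w = ω whose set of values {A_n : n ∈ ω} is
   denumerable. *)
Definition denumerable_family (w A : M) : Prop :=
  is_omega w /\ function_on A w /\
  exists R : M, is_range R A /\ denumerable R.

(* C = {x ∈ [X]^{≤ω} : (∀z ∈ A) x ∩ z ≠ ∅} *)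
Definition is_C (X A C : M) : Prop :=
  C ≐ {{ x | countable_subset x X /\ forall z : M, z ∈ A -> meets x z }}.

Definition is_B (A B : M) : Prop :=
  B ≐ {{ Z | countable Z /\ partition Z A /\
    forall P : M, P ∈ Z ->
      exists U x : M, is_union U P /\ finite_subset x U /\
        forall z : M, z ∈ P -> meets x z }}.

(* C is the sequence (C_n) attached to the sequence (A_n). *)
Definition C_sequence (w X A C : M) : Prop :=
  function_on C w /\
  forall n a c : M, maps A n a -> maps C n c -> is_C X a c.

Definition B_sequence (w A B : M) : Prop :=
  function_on B w /\
  forall n a b : M, maps A n a -> maps B n b -> is_B a b.

(* Conditions (a) and (b) of PS_0(I) and PS_0(II). *)
Definition hypotheses_I_II (w X A C : M) : Prop :=
  uncountable X /\ denumerable_family w A /\ C_sequence w X A C /\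
  (forall n a : M, maps A n a ->
     nonempty a /\
     forall z : M, z ∈ a -> finite_subset z X /\ nonempty z) /\
  (forall n c : M, maps C n c -> nonempty c).

(* Conditions (c) and (d) of PS_0(C). *)
Definition hypotheses_C (w X A B : M) : Prop :=
  uncountable X /\ denumerable_family w A /\ B_sequence w A B /\
  (forall n a : M, maps A n a ->
     uncountable a /\
     forall z : M, z ∈ a -> finite_subset z X /\ nonempty z) /\
  (forall n b : M, maps B n b -> nonempty b).

End Notions.

Definition CUC (M : set_structure) : Prop :=
  forall F U : M, countable F -> (forall A : M, A ∈ F -> countable A) ->
    is_union U F -> countable U.

Definition PS0 (M : set_structure) : Prop :=
  forall X : M, uncountable X ->
    forall S T : M, is_space_S X S T -> P_space S T.

Definition PS0_I (M : set_structure) : Prop :=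
  forall w X A C : M, hypotheses_I_II w X A C ->
    exists x : M, forall n c : M, maps C n c -> x ∈ c.

Definition PS0_II (M : set_structure) : Prop :=
  forall w X A C : M, hypotheses_I_II w X A C ->
    forall R : M, is_range R C -> exists f : M, choice_function f R.

Definition PS0_C (M : set_structure) : Prop :=
  forall w X A B : M, hypotheses_C w X A B ->
    forall R : M, is_range R B -> exists f : M, choice_function f R.

(* Main.v *)
(* Call a set which meets every member of a family a hitting set of the family.  All the
   statements are compared with the principle [common_hitting]: if each of countably many
   families of finite sets has a countable hitting set, then they have a common one.

   - PS_0 gives [common_hitting]: the finite sets disjoint from some countable hitting set of
     the n-th family form an open set, and a basic neighbourhood of the empty set inside the
     intersection of these open sets avoids a common hitting set.  Conversely, if x lies in
     the open sets U_n, apply [common_hitting] to the families of all y \ x with x included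
     in y and y not in U_n.
   - Families of singletons give CUC, and under CUC the union of chosen hitting sets is a
     common one.
   - An enumerated hitting set partitions a family according to the least point of the
     hitting set in a given member, uniformly in the family.  Conversely, by CUC the chosen
     partitions have countably many blocks in all, and a block with a finite hitting set has
     only countably many points in its hitting sets of minimal size. *)

Require Import Defs.
From Stdlib Require Import ClassicalEpsilon.

Set Implicit Arguments.

(** * First-order definability with parameters *)

Section Definability.
Context {M : set_structure}.
Implicit Types (e : nat -> M) (P Q : (nat -> M) -> Prop) (t : (nat -> M) -> M).

Lemma sat_ext p : forall e e', (forall n, e n = e' n) -> sat M e p <-> sat M e' p.
Proof.
  induction p; intros e e' H; simpl.
  - rewrite !H; tauto.
  - rewrite !H; tauto.
  - tauto.
  - rewrite (IHp1 e e' H), (IHp2 e e' H); tauto.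
  - rewrite (IHp1 e e' H), (IHp2 e e' H); tauto.
  - rewrite (IHp1 e e' H), (IHp2 e e' H); tauto.
  - assert (K : forall x, sat M (scons x e) p <-> sat M (scons x e') p)
      by (intro x; apply IHp; intros [|n]; simpl; auto).
    split; intros L x; apply K, L.
  - assert (K : forall x, sat M (scons x e) p <-> sat M (scons x e') p)
      by (intro x; apply IHp; intros [|n]; simpl; auto).
    split; intros [x L]; exists x; apply K, L.
Qed.

Definition up (s : nat -> nat) (n : nat) : nat :=
  match n with 0 => 0 | S k => S (s k) end.

Fixpoint ren (s : nat -> nat) (p : formula) : formula :=
  match p with
  | f_mem i j => f_mem (s i) (s j)
  | f_eq i j => f_eq (s i) (s j)
  | f_bot => f_bot
  | f_imp p q => f_imp (ren s p) (ren s q)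
  | f_and p q => f_and (ren s p) (ren s q)
  | f_or p q => f_or (ren s p) (ren s q)
  | f_all p => f_all (ren (up s) p)
  | f_ex p => f_ex (ren (up s) p)
  end.

Lemma sat_ren p : forall s e, sat M e (ren s p) <-> sat M (fun n => e (s n)) p.
Proof.
  induction p; intros s e; simpl; try tauto.
  1-3: rewrite IHp1, IHp2; tauto.
  all: assert (K : forall x, sat M (scons x e) (ren (up s) p) <->
                   sat M (scons x (fun n => e (s n))) p)
      by (intro x; rewrite IHp; apply sat_ext; intros [|n]; reflexivity).
  - split; intros L x; apply K, L.
  - split; intros [x L]; exists x; apply K, L.
Qed.

Definition resolve (r : nat -> nat + M) e (i : nat) : M :=
  match r i with inl j => e j | inr m => m end.

(* [Def P]: the predicate [P] on environments is given by a first-order formula with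
   parameters; [r] says which variables of the formula stand for entries of the environment
   and which ones for parameters. *)
Definition Def P : Prop :=
  exists p r, forall e, sat M (resolve r e) p <-> P e.

(* A term is definable through its graph; the value is entry [0]. *)
Definition DefT t : Prop := Def (fun e => e 0 = t (fun n => e (S n))).

Lemma def_ext P Q : (forall e, P e <-> Q e) -> Def P -> Def Q.
Proof.
  intros H (p & r & K); exists p, r; intro e; rewrite <- H; apply K.
Qed.

Fixpoint dbl (n : nat) : nat := match n with 0 => 0 | S k => S (S (dbl k)) end.

Fixpoint interleave {T : Type} (r r' : nat -> T) (n : nat) : T :=
  match n with
  | 0 => r 0
  | 1 => r' 0
  | S (S k) => interleave (fun i => r (S i)) (fun i => r' (S i)) k
  end.

Lemma interleave_even T n : forall r r' : nat -> T, interleave r r' (dbl n) = r n.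
Proof. induction n; intros r r'; simpl; [|rewrite IHn]; reflexivity. Qed.

Lemma interleave_odd T n : forall r r' : nat -> T, interleave r r' (S (dbl n)) = r' n.
Proof.
  induction n; intros r r'; [reflexivity|].
  exact (IHn (fun i => r (S i)) (fun i => r' (S i))).
Qed.

(** The two formulas come with different readings of their variables. Renaming the variables of one
    to even and those of the other to odd indices lets a single reading serve both. *)
Lemma def_merge P Q : Def P -> Def Q ->
  exists p q r, (forall e, sat M (resolve r e) p <-> P e) /\
                (forall e, sat M (resolve r e) q <-> Q e).
Proof.
  intros (p & r & H) (q & r' & K).
  exists (ren dbl p), (ren (fun n => S (dbl n)) q), (interleave r r').
  split; intro e; [rewrite <- H | rewrite <- K]; rewrite sat_ren; apply sat_ext;
    intro n; unfold resolve; [rewrite interleave_even | rewrite interleave_odd];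
    reflexivity.
Qed.

Lemma def_and P Q : Def P -> Def Q -> Def (fun e => P e /\ Q e).
Proof.
  intros H K; destruct (def_merge H K) as (p & q & r & L & N).
  exists (f_and p q), r; intro e; simpl; rewrite L, N; tauto.
Qed.

Lemma def_or P Q : Def P -> Def Q -> Def (fun e => P e \/ Q e).
Proof.
  intros H K; destruct (def_merge H K) as (p & q & r & L & N).
  exists (f_or p q), r; intro e; simpl; rewrite L, N; tauto.
Qed.

Lemma def_imp P Q : Def P -> Def Q -> Def (fun e => P e -> Q e).
Proof.
  intros H K; destruct (def_merge H K) as (p & q & r & L & N).
  exists (f_imp p q), r; intro e; simpl; rewrite L, N; tauto.
Qed.

(** The truth value of [A] is decided classically outside the model, and truth and falsity are both
    formulas. *)
Lemma def_closed (A : Prop) : Def (fun _ => A).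
Proof.
  destruct (classic A) as [H|H].
  - exists (f_imp f_bot f_bot), inl; simpl; tauto.
  - exists f_bot, inl; simpl; tauto.
Qed.

Lemma def_not P : Def P -> Def (fun e => ~ P e).
Proof. intro H; apply (def_imp H), def_closed. Qed.

Lemma def_iff P Q : Def P -> Def Q -> Def (fun e => P e <-> Q e).
Proof. intros H K; apply def_and; apply def_imp; assumption. Qed.

(* Under a binder the formula variable [0] is the bound one, whatever variables [r] sends to
   entry [0] of the extended environment. *)
Definition bind_var (r : nat -> nat + M) (n : nat) : nat :=
  match r n with inl 0 => 0 | _ => S n end.

Definition bind_res (r : nat -> nat + M) (n : nat) : nat + M :=
  match r n with inl (S k) => inl k | inl 0 => inl 0 | inr m => inr m end.

Lemma sat_bind p r x e :
  sat M (scons x (resolve (bind_res r) e)) (ren (bind_var r) p) <->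
  sat M (resolve r (scons x e)) p.
Proof.
  rewrite sat_ren; apply sat_ext; intro n; unfold bind_var, resolve.
  destruct (r n) as [[|k]|m] eqn:E; simpl; trivial; unfold bind_res; rewrite E;
    reflexivity.
Qed.

Lemma def_bind (B : (nat -> M) -> M -> Prop) :
  Def (fun e => B (fun n => e (S n)) (e 0)) ->
  exists p r, forall e x, sat M (scons x (resolve r e)) p <-> B e x.
Proof.
  intros (p & r & H); exists (ren (bind_var r) p), (bind_res r); intros e x.
  rewrite sat_bind, H; reflexivity.
Qed.

(** The shape that Replacement asks for, with argument and value as the two leading variables. The
    second variable is bound by repeating the renaming of [def_bind] under [up]. *)
Lemma def_bind2 (R : M -> M -> Prop) :
  Def (fun e => R (e 0) (e 1)) ->
  exists p r, forall e x y, sat M (scons x (scons y (resolve r e))) p <-> R x y.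
Proof.
  intro H; destruct (def_bind (fun e x => R x (e 0)) H) as (p & r & K).
  exists (ren (up (bind_var r)) p), (bind_res r); intros e x y.
  rewrite <- (K (scons y e) x), sat_ren; apply sat_ext; intros [|n]; [reflexivity|].
  simpl; unfold bind_var, resolve, bind_res; destruct (r n) as [[|k]|m] eqn:E; simpl;
    rewrite ?E; reflexivity.
Qed.

Lemma def_all (B : (nat -> M) -> M -> Prop) :
  Def (fun e => B (fun n => e (S n)) (e 0)) -> Def (fun e => forall x, B e x).
Proof.
  intro H; destruct (def_bind B H) as (p & r & K); exists (f_all p), r; intro e.
  split; intros L x; apply K, L.
Qed.

Lemma def_ex (B : (nat -> M) -> M -> Prop) :
  Def (fun e => B (fun n => e (S n)) (e 0)) -> Def (fun e => exists x, B e x).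
Proof.
  intro H; destruct (def_bind B H) as (p & r & K); exists (f_ex p), r; intro e.
  split; intros [x L]; exists x; apply K, L.
Qed.

Lemma def_ren (s : nat -> nat) P : Def P -> Def (fun e => P (fun n => e (s n))).
Proof.
  intros (p & r & H).
  exists p, (fun n => match r n with inl j => inl (s j) | inr m => inr m end); intro e.
  rewrite <- H; apply sat_ext; intro n; unfold resolve; destruct (r n); reflexivity.
Qed.

Lemma defT_var j : DefT (fun e => e j).
Proof. exists (f_eq 0 1), (fun n => inl (match n with 0 => 0 | _ => S j end)); reflexivity. Qed.

Lemma defT_param (m : M) : DefT (fun _ => m).
Proof.
  exists (f_eq 0 1), (fun n => match n with 0 => inl 0 | _ => inr m end); reflexivity.
Qed.

(** The language has no function symbols, so the value of the term is named by an existential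
    quantifier over its graph. *)
Lemma def_subst1 (R : M -> Prop) t :
  Def (fun e => R (e 0)) -> DefT t -> Def (fun e => R (t e)).
Proof.
  intros H K.
  apply def_ext with (fun e => exists x, x = t e /\ R x).
  - intro e; split; [intros (x & -> & L); exact L | intro L; eauto].
  - apply def_ex, def_and; [exact K | exact H].
Qed.

Lemma defT_shift t : DefT t -> DefT (fun e => t (fun n => e (S n))).
Proof. exact (@def_ren (fun n => match n with 0 => 0 | S k => S (S k) end) _). Qed.

Lemma def_subst2 (R : M -> M -> Prop) t u :
  Def (fun e => R (e 0) (e 1)) -> DefT t -> DefT u -> Def (fun e => R (t e) (u e)).
Proof.
  intros H K L.
  apply def_ext with (fun e => exists x, x = t e /\ R x (u e)).
  - intro e; split; [intros (x & -> & N); exact N | intro N; eauto].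
  - apply def_ex, def_and; [exact K |].
    apply def_ext with (fun e => exists y, y = u (fun n => e (S n)) /\ R (e 0) y).
    + intro e; split; [intros (x & -> & N); exact N | intro N; eauto].
    + apply def_ex, def_and; [exact (defT_shift L)|].
      (* The quantifier over [y] is the innermost one, so [y] has index 0 and [x] index 1; the
         renaming restores the order of the arguments. *)
      exact (def_ren (fun n => match n with 0 => 1 | _ => 0 end) H).
Qed.

Lemma def_subst3 (R : M -> M -> M -> Prop) t u v :
  Def (fun e => R (e 0) (e 1) (e 2)) -> DefT t -> DefT u -> DefT v ->
  Def (fun e => R (t e) (u e) (v e)).
Proof.
  intros H K L N.
  apply def_ext with (fun e => exists x, x = t e /\ R x (u e) (v e)).
  - intro e; split; [intros (x & -> & O); exact O | intro O; eauto].
  - apply def_ex, def_and; [exact K |].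
    apply def_ext with (fun e => exists y, y = u (fun n => e (S n)) /\
      R (e 0) y (v (fun n => e (S n)))).
    + intro e; split; [intros (x & -> & O); exact O | intro O; eauto].
    + apply def_ex, def_and; [exact (defT_shift L)|].
      apply def_ext with (fun e => exists z, z = v (fun n => e (S (S n))) /\
        R (e 1) (e 0) z).
      * intro e; split; [intros (x & -> & O); exact O | intro O; eauto].
      * apply def_ex, def_and; [exact (defT_shift (defT_shift N))|].
        exact (def_ren (fun n => match n with 0 => 2 | 1 => 1 | _ => 0 end) H).
Qed.

Lemma defT_fun1 (f : M -> M) t :
  Def (fun e => e 0 = f (e 1)) -> DefT t -> DefT (fun e => f (t e)).
Proof.
  intros H K; exact (def_subst2 (fun x y => x = f y) H (defT_var 0) (defT_shift K)).
Qed.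

Lemma defT_fun2 (f : M -> M -> M) t u :
  Def (fun e => e 0 = f (e 1) (e 2)) -> DefT t -> DefT u -> DefT (fun e => f (t e) (u e)).
Proof.
  intros H K L.
  exact (def_subst3 (fun x y z => x = f y z) H (defT_var 0) (defT_shift K) (defT_shift L)).
Qed.

Lemma def_mem_var i j : Def (fun e => e i ∈ e j).
Proof. exists (f_mem i j), inl; reflexivity. Qed.

Lemma def_eq_var i j : Def (fun e => e i = e j).
Proof. exists (f_eq i j), inl; reflexivity. Qed.

Lemma def_mem t u : DefT t -> DefT u -> Def (fun e => t e ∈ u e).
Proof. exact (def_subst2 mem (def_mem_var 0 1)). Qed.

Lemma def_eq t u : DefT t -> DefT u -> Def (fun e => t e = u e).
Proof. exact (def_subst2 eq (def_eq_var 0 1)). Qed.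

End Definability.

(** * Proof search for definability *)

Ltac defn_ext := fail.
Ltac defT_ext := fail.

Ltac defT :=
  cbv beta;
  first [ apply defT_param | apply defT_var | assumption | defT_ext ].

(** Logical structure is split off first, and set-theoretic notions are unfolded only when nothing
    else applies. The hooks [defT_ext] and [defn_ext] are redefined once new terms and predicates
    are available. *)
Ltac defn :=
  cbv beta;
  first
  [ assumption
  | apply def_closed
  | lazymatch goal with
    | |- Def (fun e => @?A e /\ @?B e) => apply (@def_and _ A B); defn
    | |- Def (fun e => @?A e \/ @?B e) => apply (@def_or _ A B); defn
    | |- Def (fun e => ~ @?A e) => apply (@def_not _ A); defn
    | |- Def (fun e => @?A e <-> @?B e) => apply (@def_iff _ A B); defn
    | |- Def (fun e => exists x, @?B e x) => apply (@def_ex _ B); defn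
    | |- Def (fun e => @?t e ∈ @?u e) => apply (@def_mem _ t u); defT
    | |- Def (fun e => @?t e = @?u e) => apply (@def_eq _ t u); defT
    | |- Def (fun e => @?A e -> @?B e) => apply (@def_imp _ A B); defn
    | |- Def (fun e => forall x, @?B e x) => apply (@def_all _ B); defn
    end
  | match goal with
    | H : Def (fun e => ?R (e 0)) |- Def (fun e => ?R (@?t e)) =>
        apply (@def_subst1 _ R t H); defT
    | H : Def (fun e => ?R (e 0) (e 1)) |- Def (fun e => ?R (@?t e) (@?u e)) =>
        apply (@def_subst2 _ R t u H); defT
    end
  | defn_ext
  | progress unfold subset, nonempty, meets, disjoint, is_empty, is_upair, is_union,
      is_succ, inductive, is_set_of, is_opair, maps, function_on, unique, is_range,
      injection, bijection, equipotent, is_omega, finite, countable, uncountable,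
      finite_subset, countable_subset, not; defn ].

Unset Strict Implicit.

(** * Elementary set theory inside the model *)

Section SetTheory.
Context {M : set_structure} (HM : ZF M).
Implicit Types (x y z a b f g m n w h A B C D F X Z : M) (P : M -> Prop)
  (R : M -> M -> Prop).

Lemma set_inhabited : inhabited M.
Proof. destruct (zf_infinity HM) as [w _]; exact (inhabits w). Qed.

(* Unspecified when the class [P] is not a set.  The choice operator leaks no choice into the
   model: it only names sets determined by their members, and separation and replacement are
   applied to [Def] predicates only. *)
Definition setof P : M := epsilon set_inhabited (fun B => B ≐ {{x | P x}}).

Lemma in_setof P : (exists B, B ≐ {{x | P x}}) -> forall x, x ∈ setof P <-> P x.
Proof. intro H; exact (epsilon_spec set_inhabited _ H). Qed.

Lemma set_ext A B : (forall x, x ∈ A <-> x ∈ B) -> A = B.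
Proof. apply (zf_extensionality HM). Qed.

Definition sep A P : M := setof (fun x => x ∈ A /\ P x).

Lemma in_sep A P : Def (fun e => P (e 0)) -> forall x, x ∈ sep A P <-> x ∈ A /\ P x.
Proof.
  intro H; apply in_setof; destruct (def_bind (fun _ => P) H) as (p & r & K).
  destruct (zf_separation HM p (resolve r (fun _ => A)) A) as [B HB].
  exists B; intro x; rewrite (HB x), (K (fun _ => A) x); reflexivity.
Qed.

Lemma replacement_exists R A : Def (fun e => R (e 0) (e 1)) ->
  (forall x y y', x ∈ A -> R x y -> R x y' -> y = y') ->
  exists B, B ≐ {{y | exists x, x ∈ A /\ R x y}}.
Proof.
  intros H U; destruct (def_bind2 _ H) as (p & r & K).
  destruct (zf_replacement HM p (resolve r (fun _ => A)) A) as [B HB].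
  - intros x y y' Hx; rewrite !K; eauto.
  - exists B; intro y; rewrite (HB y).
    split; intros (x & Hx & L); exists x; (split; [exact Hx|]); revert L; apply K.
Qed.

Definition empty : M := setof (fun _ => False).
Definition upair x y : M := setof (fun t => t = x \/ t = y).
Definition bigcup F : M := setof (fun t => exists B, B ∈ F /\ t ∈ B).
Definition power A : M := setof (fun y => y ⊆ A).
Definition cup A B : M := bigcup (upair A B).
Definition succ x : M := cup x (upair x x).
Definition opair x y : M := upair (upair x x) (upair x y).
Definition omega : M := setof (fun x => forall v, inductive v -> x ∈ v).

Lemma in_empty x : ~ x ∈ empty.
Proof.
  intro H; apply (@in_setof (fun _ => False)) in H; [exact H|].
  destruct set_inhabited as [A]; exists (sep A (fun _ => False)).
  intro y; rewrite in_sep by defn; tauto.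
Qed.

Lemma in_upair x y t : t ∈ upair x y <-> t = x \/ t = y.
Proof. exact (in_setof (zf_pairing HM x y) t). Qed.

Lemma in_bigcup F t : t ∈ bigcup F <-> exists B, B ∈ F /\ t ∈ B.
Proof. exact (in_setof (zf_union HM F) t). Qed.

Lemma in_power A y : y ∈ power A <-> y ⊆ A.
Proof. exact (in_setof (zf_power HM A) y). Qed.

Lemma in_cup A B t : t ∈ cup A B <-> t ∈ A \/ t ∈ B.
Proof.
  unfold cup; rewrite in_bigcup; split.
  - intros (C & H & K); apply in_upair in H; destruct H; subst; auto.
  - intros [H|H]; [exists A | exists B]; rewrite in_upair; auto.
Qed.

Lemma in_succ x t : t ∈ succ x <-> t ∈ x \/ t = x.
Proof. unfold succ; rewrite in_cup, in_upair; tauto. Qed.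

Lemma is_empty_iff x : is_empty x <-> x = empty.
Proof.
  split; [|intros -> t; split; [apply in_empty | tauto]].
  intro H; apply set_ext; intro t; rewrite (H t); split; [tauto | apply in_empty].
Qed.

Lemma is_upair_iff p x y : is_upair p x y <-> p = upair x y.
Proof.
  split; [|intros -> t; apply in_upair].
  intro H; apply set_ext; intro t; rewrite (H t), in_upair; reflexivity.
Qed.

Lemma is_union_iff U F : is_union U F <-> U = bigcup F.
Proof.
  split; [|intros -> t; apply in_bigcup].
  intro H; apply set_ext; intro t; rewrite (H t), in_bigcup; reflexivity.
Qed.

Lemma is_succ_iff s x : is_succ s x <-> s = succ x.
Proof.
  split; [|intros -> t; apply in_succ].
  intro H; apply set_ext; intro t; rewrite (H t), in_succ; reflexivity.
Qed.

Lemma is_opair_iff p x y : is_opair p x y <-> p = opair x y.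
Proof.
  unfold is_opair; split.
  - intros (a & b & H & K & L); apply is_upair_iff in H, K, L; subst; reflexivity.
  - intros ->; exists (upair x x), (upair x y); rewrite !is_upair_iff; auto.
Qed.

Lemma upair_inj x y y' : upair x y = upair x y' -> y = y'.
Proof.
  intro H.
  assert (K : y ∈ upair x y') by (rewrite <- H; apply in_upair; auto).
  assert (L : y' ∈ upair x y) by (rewrite H; apply in_upair; auto).
  apply in_upair in K, L; destruct K, L; congruence.
Qed.

Lemma opair_inj x y x' y' : opair x y = opair x' y' -> x = x' /\ y = y'.
Proof.
  intro H.
  assert (E : x = x').
  { assert (K : upair x x ∈ opair x' y') by (rewrite <- H; apply in_upair; auto).
    apply in_upair in K.
    assert (L : x' ∈ upair x x) by (destruct K as [-> | ->]; apply in_upair; auto).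
    apply in_upair in L; destruct L; auto. }
  (* With equal first coordinates, cancelling the common entry of the outer unordered pair and then
     that of the inner one leaves the second coordinates. *)
  subst; split; trivial; apply (@upair_inj x'), (@upair_inj (upair x' x')); exact H.
Qed.

(** The term is built with the operator [setof], but its graph is the first-order relation
    [is_upair]. The next two lemmas follow the same pattern. *)
Lemma defT_upair t u : DefT t -> DefT u -> DefT (fun e => upair (t e) (u e)).
Proof.
  apply (defT_fun2 upair), def_ext with (fun e => is_upair (e 0) (e 1) (e 2)); [|defn].
  intro e; apply is_upair_iff.
Qed.

Lemma defT_opair t u : DefT t -> DefT u -> DefT (fun e => opair (t e) (u e)).
Proof.
  apply (defT_fun2 opair), def_ext with (fun e => is_opair (e 0) (e 1) (e 2)); [|defn].
  intro e; apply is_opair_iff.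
Qed.

Lemma defT_succ t : DefT t -> DefT (fun e => succ (t e)).
Proof.
  apply (defT_fun1 succ), def_ext with (fun e => is_succ (e 0) (e 1)); [|defn].
  intro e; apply is_succ_iff.
Qed.

Ltac defT_ext ::=
  first [ apply defT_upair | apply defT_opair | apply defT_succ ]; defT.

Lemma maps_iff f x y : maps f x y <-> opair x y ∈ f.
Proof.
  unfold maps; split.
  - intros (p & H & K); apply is_opair_iff in H; subst; exact K.
  - intro H; exists (opair x y); rewrite is_opair_iff; auto.
Qed.

Lemma function_dom f A x y : function_on f A -> maps f x y -> x ∈ A.
Proof.
  intros [H _] K; apply maps_iff in K; destruct (H _ K) as (x' & y' & Hx & E).
  apply is_opair_iff, opair_inj in E; destruct E; subst; exact Hx.
Qed.

Lemma function_total f A x : function_on f A -> x ∈ A -> exists y, maps f x y.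
Proof. intros [_ H] K; destruct (H _ K) as (y & L & _); eauto. Qed.

Lemma function_unique f A x y y' : function_on f A -> maps f x y -> maps f x y' -> y = y'.
Proof.
  intros H K L; destruct H as [H1 H2] eqn:E.
  destruct (H2 _ (function_dom H K)) as (z & _ & U).
  rewrite <- (U _ K), <- (U _ L); reflexivity.
Qed.

Lemma function_exists R A : Def (fun e => R (e 0) (e 1)) ->
  (forall x, x ∈ A -> exists y, R x y) ->
  (forall x y y', x ∈ A -> R x y -> R x y' -> y = y') ->
  exists f, function_on f A /\ forall x y, maps f x y <-> x ∈ A /\ R x y.
Proof.
  intros HR T U.
  destruct (@replacement_exists (fun x p => exists y, R x y /\ p = opair x y) A)
    as [f Hf].
  - defn.
  - intros x p p' Hx (y & H & ->) (y' & H' & ->); rewrite (U x y y'); auto.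
  - assert (K : forall x y, maps f x y <-> x ∈ A /\ R x y).
    { intros x y; rewrite maps_iff, (Hf (opair x y)); split.
      - intros (x' & Hx & y' & H & E); apply opair_inj in E; destruct E; subst; auto.
      - intros [Hx H]; eauto. }
    exists f; split; [split|exact K].
    + intros p Hp; apply Hf in Hp; destruct Hp as (x & Hx & y & _ & ->).
      exists x, y; rewrite is_opair_iff; auto.
    + intros x Hx; destruct (T x Hx) as [y Hy]; exists y; split; [apply K; auto|].
      intros y' H; apply K in H; apply (U x); tauto.
Qed.

(** * Natural numbers *)

Lemma not_self_mem x : ~ x ∈ x.
Proof.
  intro H; destruct (@zf_foundation _ HM (upair x x)) as (y & K & L).
  - exists x; apply in_upair; auto.
  - apply in_upair in K; assert (y = x) by tauto; subst.
    apply L; exists x; rewrite in_upair; auto.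
Qed.

Lemma mem_asym x y : x ∈ y -> ~ y ∈ x.
Proof.
  intros H H'; destruct (@zf_foundation _ HM (upair x y)) as (t & K & L).
  - exists x; apply in_upair; auto.
  - apply in_upair in K; destruct K; subst; apply L; [exists y | exists x];
      rewrite in_upair; auto.
Qed.

Lemma succ_inj x y : succ x = succ y -> x = y.
Proof.
  intro H.
  assert (K : x ∈ succ y) by (rewrite <- H; apply in_succ; auto).
  assert (L : y ∈ succ x) by (rewrite H; apply in_succ; auto).
  apply in_succ in K, L; destruct K as [K|K], L as [L|L]; auto.
  destruct (mem_asym K L).
Qed.

Lemma in_omega x : x ∈ omega <-> forall v, inductive v -> x ∈ v.
Proof.
  apply in_setof; destruct (zf_infinity HM) as [w Hw].
  exists (sep w (fun x => forall v, inductive v -> x ∈ v)).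
  intro y; rewrite in_sep by defn; split; [tauto|auto].
Qed.

Lemma omega_empty : empty ∈ omega.
Proof.
  apply in_omega; intros v [(o & H & K) _]; apply is_empty_iff in H; subst; exact K.
Qed.

Lemma omega_succ n : n ∈ omega -> succ n ∈ omega.
Proof.
  rewrite !in_omega; intros H v Hv; destruct Hv as [H1 H2] eqn:E.
  destruct (H2 _ (H v Hv)) as (s & K & L); apply is_succ_iff in K; subst; exact L.
Qed.

Lemma is_omega_iff w : is_omega w <-> w = omega.
Proof.
  assert (I : inductive omega).
  { split.
    - exists empty; rewrite is_empty_iff; auto using omega_empty.
    - intros x Hx; exists (succ x); rewrite is_succ_iff; auto using omega_succ. }
  split.
  - intros [H K]; apply set_ext; intro x; rewrite in_omega; split.
    + intros Hx v Hv; exact (K v Hv x Hx).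
    + auto.
  - intros ->; split; [exact I|]; intros v Hv x Hx; rewrite in_omega in Hx; auto.
Qed.

(** Induction is restricted to definable classes, because separation must turn the class into an
    inductive set. *)
Lemma omega_ind P : Def (fun e => P (e 0)) -> P empty ->
  (forall n, n ∈ omega -> P n -> P (succ n)) -> forall n, n ∈ omega -> P n.
Proof.
  intros HP H0 HS n Hn; rewrite in_omega in Hn.
  cut (n ∈ sep omega P); [rewrite in_sep by exact HP; tauto|].
  apply Hn; split.
  - exists empty; rewrite is_empty_iff, in_sep by exact HP; auto using omega_empty.
  - intros x Hx; rewrite in_sep in Hx by exact HP; exists (succ x).
    rewrite is_succ_iff, in_sep by exact HP; destruct Hx; auto using omega_succ.
Qed.

Lemma omega_trans n x : n ∈ omega -> x ∈ n -> x ∈ omega.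
Proof.
  intro Hn; revert n Hn x; apply (@omega_ind (fun n => forall x, x ∈ n -> x ∈ omega)).
  - defn.
  - intros x Hx; destruct (in_empty Hx).
  - intros n Hn IH x; rewrite in_succ; intros [H| ->]; auto.
Qed.

Lemma succ_mem n m : m ∈ omega -> n ∈ m -> succ n ∈ succ m.
Proof.
  intro Hm; revert m Hm n.
  apply (@omega_ind (fun m => forall n, n ∈ m -> succ n ∈ succ m)).
  - defn.
  - intros n Hn; destruct (in_empty Hn).
  - intros m Hm IH n; rewrite in_succ; intros [H| ->]; apply in_succ; auto.
Qed.

Lemma nat_trichotomy n m : n ∈ omega -> m ∈ omega -> n ∈ m \/ n = m \/ m ∈ n.
Proof.
  intro Hn; revert n Hn m.
  apply (@omega_ind (fun n => forall m, m ∈ omega -> n ∈ m \/ n = m \/ m ∈ n)).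
  - defn.
  - apply (@omega_ind (fun m => empty ∈ m \/ empty = m \/ m ∈ empty)); [defn|auto|].
    intros m Hm [H|[<-|H]]; [| |destruct (in_empty H)]; left; apply in_succ; auto.
  - intros n Hn IH m Hm; destruct (IH m Hm) as [H|[<-|H]].
    + apply succ_mem in H; trivial; apply in_succ in H; tauto.
    + rewrite in_succ; auto.
    + rewrite (in_succ n); auto.
Qed.

Definition least P n : Prop := n ∈ omega /\ P n /\ forall m, m ∈ n -> ~ P m.

(** Foundation gives an ∈-minimal number with the property; it is least because members of natural
    numbers are natural numbers. *)
Lemma least_exists P n : Def (fun e => P (e 0)) -> n ∈ omega -> P n -> exists m, least P m.
Proof.
  intros HP Hn H; destruct (@zf_foundation _ HM (sep omega P)) as (m & K & L).
  - exists n; rewrite in_sep by exact HP; auto.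
  - rewrite in_sep in K by exact HP; exists m; repeat split; try tauto.
    intros k Hk Q; apply L; exists k; rewrite in_sep by exact HP.
    repeat split; trivial; apply (@omega_trans m); tauto.
Qed.

Lemma least_unique P n m : least P n -> least P m -> n = m.
Proof.
  intros (Hn & H & K) (Hm & H' & K').
  destruct (nat_trichotomy Hn Hm) as [L|[L|L]]; trivial; firstorder.
Qed.

(** * Countable sets *)

Lemma countable_elim A : countable A -> exists g, injection g A omega.
Proof. intros (w & g & H & K); apply is_omega_iff in H; subst; eauto. Qed.

(** A point may be related to many numbers. Taking the least of them gives an injection without
    choice. *)
Lemma countable_intro R A : Def (fun e => R (e 0) (e 1)) ->
  (forall x, x ∈ A -> exists n, n ∈ omega /\ R x n) ->
  (forall x x' n, x ∈ A -> x' ∈ A -> R x n -> R x' n -> x = x') ->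
  countable A.
Proof.
  intros HR T I.
  destruct (@function_exists (fun x n => least (R x) n) A) as (f & Hf & K).
  - unfold least; defn.
  - intros x Hx; destruct (T x Hx) as (n & Hn & H).
    apply least_exists with n; trivial; exact (def_subst2 R HR (defT_param x) (defT_var 0)).
  - intros x y y' _; apply least_unique.
  - exists omega, f; split; [apply is_omega_iff; reflexivity|].
    repeat split; try apply Hf.
    + intros x y H; apply K in H; apply H.
    + intros x x' y H H'; apply K in H, H'; unfold least in *; apply (I x x' y); tauto.
Qed.

(** A point of [B] is related to the numbers of all its preimages in [A], and [countable_intro]
    selects one of them. *)
Lemma countable_image R A B : countable A -> Def (fun e => R (e 0) (e 1)) ->
  (forall y, y ∈ B -> exists x, x ∈ A /\ R x y) ->
  (forall x y y', x ∈ A -> y ∈ B -> y' ∈ B -> R x y -> R x y' -> y = y') ->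
  countable B.
Proof.
  intros HA HR T U; destruct (countable_elim HA) as (g & Hg & Hg' & Hi).
  apply (@countable_intro (fun y n => exists x, x ∈ A /\ maps g x n /\ R x y)).
  - defn.
  - intros y Hy; destruct (T y Hy) as (x & Hx & H).
    destruct (function_total Hg Hx) as [n Hn]; exists n; split; [exact (Hg' _ _ Hn)|eauto].
  - intros y y' n Hy Hy' (x & Hx & H & K) (x' & _ & H' & K').
    rewrite <- (Hi _ _ _ H H') in K'; eauto.
Qed.

Lemma countable_sub A B : countable A -> B ⊆ A -> countable B.
Proof.
  intros HA H; apply (@countable_image eq A B HA); [defn|eauto|congruence].
Qed.

Lemma countable_upair x y : countable (upair x y).
Proof.
  apply (@countable_intro (fun t n => t = x /\ n = empty \/ t = y /\ n = succ empty)).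
  - defn.
  - intros t H; apply in_upair in H; destruct H as [-> | ->];
      [exists empty | exists (succ empty)]; auto using omega_empty, omega_succ.
  - assert (N : empty <> succ empty).
    { intro E; apply (@in_empty empty); rewrite E at 2; apply in_succ; auto. }
    intros t t' n _ _ [[? ?]|[? ?]] [[? ?]|[? ?]]; congruence.
Qed.

Lemma countable_cons A t : countable A -> countable (cup A (upair t t)).
Proof.
  intro HA; destruct (countable_elim HA) as (g & Hg & Hg' & Hi).
  (* The numbers of the points of [A] are shifted by one, which frees 0 for [t]. *)
  apply (@countable_intro (fun x n => x = t /\ n = empty \/
    exists m, maps g x m /\ n = succ m)).
  - defn.
  - intros x Hx; apply in_cup in Hx; rewrite in_upair in Hx.
    destruct Hx as [Hx|Hx].
    + destruct (function_total Hg Hx) as [m Hm]; exists (succ m).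
      split; [exact (omega_succ (Hg' _ _ Hm))|eauto].
    + exists empty; split; [apply omega_empty|]; left; tauto.
  - assert (N : forall m, empty <> succ m).
    { intros m E; apply (@in_empty m); rewrite E; apply in_succ; auto. }
    intros x x' n _ _ [[-> ->]|(m & H & ->)] [[-> E]|(m' & H' & E)]; trivial.
    + destruct (N _ E).
    + destruct (N m); auto.
    + apply succ_inj in E; subst; eauto.
Qed.

Lemma countable_empty : countable empty.
Proof.
  apply countable_sub with (upair empty empty); [apply countable_upair|].
  intros x H; destruct (in_empty H).
Qed.

Lemma countable_omega : countable omega.
Proof.
  apply (@countable_intro eq); [defn|eauto|congruence].
Qed.

Lemma countable_finite A : finite A -> countable A.
Proof.
  intros (w & n & Hw & Hn & f & [[Hf [Hf' Hi]] _]).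
  exists w, f; split; trivial; split; [exact Hf|split; [|exact Hi]].
  apply is_omega_iff in Hw; subst; eauto using omega_trans.
Qed.

(** * Finite sets *)

Definition injects A B : Prop := exists f, injection f A B.
Definition hits h A : Prop := forall z, z ∈ A -> meets h z.

Ltac defn_ext ::= progress unfold injects, hits, least; defn.

Lemma injects_intro R A B : Def (fun e => R (e 0) (e 1)) ->
  (forall x, x ∈ A -> exists y, R x y) ->
  (forall x y y', x ∈ A -> R x y -> R x y' -> y = y') ->
  (forall x y, x ∈ A -> R x y -> y ∈ B) ->
  (forall x x' y, x ∈ A -> x' ∈ A -> R x y -> R x' y -> x = x') ->
  exists f, injection f A B /\ forall x y, maps f x y <-> x ∈ A /\ R x y.
Proof.
  intros HR T U I J; destruct (function_exists HR T U) as (f & Hf & K).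
  exists f; split; [split; [exact Hf|split]|exact K].
  - intros x y H; apply K in H; apply (I x); tauto.
  - intros x x' y H H'; apply K in H, H'; apply (J x x' y); tauto.
Qed.

Lemma finite_elim A : finite A -> exists n, n ∈ omega /\ equipotent A n.
Proof. intros (w & n & H & K); apply is_omega_iff in H; subst; eauto. Qed.

Lemma finite_empty : finite empty.
Proof.
  exists omega, empty; split; [apply is_omega_iff; reflexivity|].
  split; [apply omega_empty|].
  destruct (@injects_intro eq empty empty) as (f & Hf & K);
    [defn|eauto|congruence|congruence|congruence|].
  exists f; split; [exact Hf|]; intro y; split.
  - intro H; destruct (in_empty H).
  - intros [x H]; apply K in H; destruct (in_empty (proj1 H)).
Qed.

Lemma finite_cons A t : finite A -> finite (cup A (upair t t)).
Proof.
  intro HA; destruct (classic (t ∈ A)) as [Ht|Ht].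
  { replace (cup A (upair t t)) with A; [exact HA|].
    apply set_ext; intro x; rewrite in_cup, in_upair; intuition congruence. }
  destruct (finite_elim HA) as (n & Hn & f & (Hf & Hf' & Hi) & Hr).
  exists omega, (succ n); split; [apply is_omega_iff; reflexivity|].
  split; [apply omega_succ, Hn|].
  destruct (@injects_intro (fun s k => maps f s k \/ s = t /\ k = n)
    (cup A (upair t t)) (succ n)) as (g & Hg & K).
  - defn.
  - intro x; rewrite in_cup, in_upair; intros [H|H].
    + destruct (function_total Hf H) as [y Hy]; eauto.
    + exists n; right; tauto.
  - intros x y y' _ [H|[-> ->]] [H'|[E ->]]; trivial.
    + exact (function_unique Hf H H').
    + subst; destruct (Ht (function_dom Hf H)).
    + destruct (Ht (function_dom Hf H')).
  - intros x y _ [H|[_ ->]]; apply in_succ; [left; exact (Hf' _ _ H)|auto].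
  - intros x x' y _ _ [H|[-> ->]] [H'|[E E']]; trivial; subst; trivial.
    + exact (Hi _ _ _ H H').
    + destruct (not_self_mem (Hf' _ _ H)).
    + destruct (not_self_mem (Hf' _ _ H')).
  - exists g; split; [exact Hg|]; intro y; split.
    + rewrite in_succ; intros [H| ->].
      * apply Hr in H; destruct H as [x H]; exists x; apply K; split; auto.
        apply in_cup; left; exact (function_dom Hf H).
      * exists t; apply K; rewrite in_cup, in_upair; auto.
    + intros [x H]; destruct Hg as (_ & I & _); exact (I _ _ H).
Qed.

Lemma finite_sing t : finite (upair t t).
Proof.
  replace (upair t t) with (cup empty (upair t t)); [apply finite_cons, finite_empty|].
  apply set_ext; intro x; rewrite in_cup; split; [|auto].
  intros [H|H]; [destruct (in_empty H)|exact H].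
Qed.

Lemma finite_upair x y : finite (upair x y).
Proof.
  replace (upair x y) with (cup (upair x x) (upair y y)); [apply finite_cons, finite_sing|].
  apply set_ext; intro s; rewrite in_cup, !in_upair; tauto.
Qed.

(** The value [v] freed by [t] is passed to the point with value [k], if there is another such
    point, so that all remaining values lie below [k]. *)
Lemma injects_remove A k t : t ∈ A -> injects A (succ k) ->
  injects (sep A (fun s => s <> t)) k.
Proof.
  intros Ht (g & Hg & Hg' & Hi); destruct (function_total Hg Ht) as [v Hv].
  destruct (@injects_intro
    (fun s m => maps g s m /\ m <> k \/ maps g s k /\ m = v)
    (sep A (fun s => s <> t)) k) as (f & Hf & _); [| | | | |exists f; exact Hf].
  - defn.
  - intros s Hs; rewrite in_sep in Hs by defn; destruct Hs as [Hs _].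
    destruct (function_total Hg Hs) as [m Hm].
    destruct (classic (m = k)); subst; eauto.
  - intros s m m' _ [[H K]|[H ->]] [[H' K']|[H' ->]]; trivial.
    + exact (function_unique Hg H H').
    + destruct (K (function_unique Hg H H')).
    + destruct (K' (function_unique Hg H' H)).
  - intros s m Hs H; rewrite in_sep in Hs by defn.
    destruct H as [[H K]|[H ->]].
    + apply Hg', in_succ in H; tauto.
    + assert (L : v ∈ succ k) by exact (Hg' _ _ Hv).
      apply in_succ in L; destruct L as [L|L]; trivial; subst.
      destruct Hs as [_ Hs]; destruct (Hs (Hi _ _ _ H Hv)).
  - intros s s' m Hs Hs' H H'; rewrite in_sep in Hs, Hs' by defn.
    destruct H as [[H K]|[H E]], H' as [[H' K']|[H' E']].
    + exact (Hi _ _ _ H H').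
    + subst m; destruct Hs as [_ Hs]; destruct (Hs (Hi _ _ _ H Hv)).
    + subst m; destruct Hs' as [_ Hs']; destruct (Hs' (Hi _ _ _ H' Hv)).
    + exact (Hi _ _ _ H H').
Qed.

Lemma injects_cons A k t : injects A k -> injects (cup A (upair t t)) (succ k).
Proof.
  intros (g & Hg & Hg' & Hi).
  destruct (@injects_intro (fun s m => maps g s m \/ ~ s ∈ A /\ m = k)
    (cup A (upair t t)) (succ k)) as (f & Hf & _); [| | | | |exists f; exact Hf].
  - defn.
  - intros s _; destruct (classic (s ∈ A)) as [Hs|Hs]; [|eauto].
    destruct (function_total Hg Hs) as [m Hm]; eauto.
  - intros s m m' _ [H|[H ->]] [H'|[H' ->]]; trivial.
    + exact (function_unique Hg H H').
    + destruct (H' (function_dom Hg H)).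
    + destruct (H (function_dom Hg H')).
  - intros s m _ [H|[_ ->]]; apply in_succ; [left; exact (Hg' _ _ H)|auto].
  - intros s s' m Hs Hs' [H|[H E]] [H'|[H' E']].
    + exact (Hi _ _ _ H H').
    + subst; destruct (not_self_mem (Hg' _ _ H)).
    + subst; destruct (not_self_mem (Hg' _ _ H')).
    + rewrite in_cup, in_upair in Hs, Hs'; intuition congruence.
Qed.

(** Finiteness asks for a bijection, while the counting arguments produce injections. The induction
    removes one point and puts it back. *)
Lemma finite_of_injects n : n ∈ omega -> forall A, injects A n -> finite A.
Proof.
  revert n; apply (@omega_ind (fun n => forall A, injects A n -> finite A)).
  - defn.
  - intros A (f & Hf & Hf' & _); replace A with empty; [apply finite_empty|].
    apply set_ext; intro x; split; intro H; [destruct (in_empty H)|].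
    destruct (function_total Hf H) as [y Hy]; destruct (in_empty (Hf' _ _ Hy)).
  - intros n Hn IH A HA; destruct (classic (nonempty A)) as [[t Ht]|N].
    + replace A with (cup (sep A (fun s => s <> t)) (upair t t)).
      * apply finite_cons, IH, injects_remove; assumption.
      * apply set_ext; intro x; rewrite in_cup, in_upair, in_sep by defn.
        destruct (classic (x = t)); subst; tauto.
    + replace A with empty; [apply finite_empty|].
      apply set_ext; intro x; split; intro H; [destruct (in_empty H)|].
      destruct N; exists x; exact H.
Qed.

Lemma injects_finite A : finite A -> exists n, n ∈ omega /\ injects A n.
Proof.
  intro H; destruct (finite_elim H) as (n & Hn & f & Hf & _); exists n; split; trivial.
  exists f; exact Hf.
Qed.

Lemma finite_sub A B : finite A -> B ⊆ A -> finite B.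
Proof.
  intros HA H; destruct (injects_finite HA) as (n & Hn & f & Hf & Hf' & Hi).
  apply (finite_of_injects Hn).
  destruct (@injects_intro (maps f) B n) as (g & Hg & _); [| | | | |exists g; exact Hg].
  - defn.
  - intros x Hx; exact (function_total Hf (H _ Hx)).
  - intros x y y' _; apply (function_unique Hf).
  - intros x y _; apply Hf'.
  - intros x x' y _ _; apply Hi.
Qed.

Lemma range_exists f A : function_on f A -> exists D, is_range D f.
Proof.
  intro Hf; destruct (@replacement_exists (maps f) A) as [D HR].
  - defn.
  - intros x y y' _; apply (function_unique Hf).
  - exists D; intro y; rewrite (HR y); split; intros [x H]; exists x; [tauto|].
    split; trivial; exact (function_dom Hf H).
Qed.

Lemma countable_range f A D : countable A -> function_on f A -> is_range D f -> countable D.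
Proof.
  intros HA Hf HR; apply (@countable_image (maps f) A); trivial.
  - defn.
  - intros y Hy; apply HR in Hy; destruct Hy as [x H]; exists x; split; trivial.
    exact (function_dom Hf H).
  - intros x y y' _ _ _; apply (function_unique Hf).
Qed.
(** * Common hitting sets *)

(* A sequence-free form of PS_0(I): the index set is any countable family of families. *)
Definition common_hitting : Prop :=
  forall F, countable F ->
    (forall A, A ∈ F -> (forall z, z ∈ A -> finite z) /\ exists h, countable h /\ hits h A) ->
    exists h, countable h /\ forall A, A ∈ F -> hits h A.

Lemma hits_sep h A X : (forall z, z ∈ A -> z ⊆ X) -> hits h A ->
  hits (sep h (fun t => t ∈ X)) A.
Proof.
  intros HX H z Hz; destruct (H z Hz) as (t & K & L); exists t.
  rewrite in_sep by defn; split; [split; [exact K|exact (HX z Hz t L)]|exact L].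
Qed.

Lemma hits_sub h h' A : h ⊆ h' -> hits h A -> hits h' A.
Proof. intros S H z Hz; destruct (H z Hz) as (t & K & L); exists t; auto. Qed.

(** A set hits all singletons of points of [A] exactly when it includes [A]. So a common hitting set
    for these families of singletons includes the whole union. *)
Lemma common_hitting_CUC : common_hitting -> CUC M.
Proof.
  intros HH F U HF HA HU; apply is_union_iff in HU; subst U.
  destruct (@replacement_exists
    (fun A D => forall z, z ∈ D <-> exists a, a ∈ A /\ z = upair a a) F) as [G HG].
  { defn. }
  { intros A D D' _ H H'; apply set_ext; intro z; rewrite H, H'; reflexivity. }
  assert (K : forall A, exists D, forall z, z ∈ D <-> exists a, a ∈ A /\ z = upair a a).
  { intro A; destruct (@replacement_exists (fun a z => z = upair a a) A) as [D HD];
      [defn|congruence|exists D; exact HD]. }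
  destruct (HH G) as (h & Hh & L).
  - apply countable_image with
      (R := fun A D => forall z, z ∈ D <-> exists a, a ∈ A /\ z = upair a a) (A := F); trivial.
    + defn.
    + intros D HD; apply HG in HD; exact HD.
    + intros A D D' _ _ _ H H'; apply set_ext; intro z; rewrite H, H'; reflexivity.
  - intros D HD; apply HG in HD; destruct HD as (A & H & HD); split.
    + intros z Hz; apply HD in Hz; destruct Hz as (a & _ & ->); apply finite_sing.
    + exists A; split; [auto|]; intros z Hz; apply HD in Hz; destruct Hz as (a & Ha & ->).
      exists a; rewrite in_upair; auto.
  - apply countable_sub with h; trivial; intros a Ha; apply in_bigcup in Ha.
    destruct Ha as (A & HAF & Ha); destruct (K A) as [D HD].
    assert (HDG : D ∈ G) by (apply HG; eauto).
    destruct (L D HDG (upair a a)) as (t & Ht & Ht'); [apply HD; eauto|].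
    apply in_upair in Ht'; assert (t = a) by tauto; subst; exact Ht.
Qed.

Lemma CUC_bigcup F : CUC M -> countable F -> (forall A, A ∈ F -> countable A) ->
  countable (bigcup F).
Proof. intros HC HF HA; apply (HC F); trivial; apply is_union_iff; reflexivity. Qed.

Lemma CUC_cup A B : CUC M -> countable A -> countable B -> countable (cup A B).
Proof.
  intros HC HA HB; apply CUC_bigcup; [exact HC|apply countable_upair|].
  intros D HD; apply in_upair in HD; destruct HD; subst; assumption.
Qed.

Lemma empty_in_succ n : n ∈ omega -> empty ∈ succ n.
Proof.
  revert n; apply (@omega_ind (fun n => empty ∈ succ n)); [defn| |];
    [|intros n _ H]; apply in_succ; auto.
Qed.

Lemma injects_empty : injects empty empty.
Proof.
  destruct (@injects_intro eq empty empty) as (f & Hf & _);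
    [defn|eauto|congruence|congruence|congruence|exists f; exact Hf].
Qed.

(** * Hitting sets of minimal finite size *)

Definition small_hitting_point A k s : Prop :=
  exists x, injects x k /\ hits x A /\ s ∈ x.

(* A family of countable sets has only few hitting sets of minimal finite size: such a set
   contains one of the countably many points [t] of a fixed member of the family, and its other
   points form a hitting set of minimal size for the members which avoid [t]. *)
Lemma countable_small_hitting_points X k : CUC M -> k ∈ omega ->
  forall A, (forall q, q ∈ A -> countable q) ->
    (forall j, j ∈ k -> forall x, injects x j -> ~ hits x A) ->
    countable (sep X (small_hitting_point A k)).
Proof.
  intros HC; revert k; apply (@omega_ind (fun k => forall A,
    (forall q, q ∈ A -> countable q) ->
    (forall j, j ∈ k -> forall x, injects x j -> ~ hits x A) ->
    countable (sep X (small_hitting_point A k)))).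
  (* The set built by [sep] is replaced by a quantified [D] with the same members, so that the
     induction statement is visibly first-order. *)
  - apply def_ext with (fun e => forall A, (forall q, q ∈ A -> countable q) ->
      (forall j, j ∈ e 0 -> forall x, injects x j -> ~ hits x A) ->
      exists D, countable D /\ forall s, s ∈ D <-> s ∈ X /\ small_hitting_point A (e 0) s).
    + assert (K : forall A k s, s ∈ sep X (small_hitting_point A k) <->
        s ∈ X /\ small_hitting_point A k s)
        by (intros; apply in_sep; unfold small_hitting_point; defn).
      intro e; split; intros H A HA HA'; specialize (H A HA HA').
      * destruct H as (D & HD & HD').
        apply countable_sub with D; trivial; intros s; rewrite K, HD'; auto.
      * eauto.
    + unfold small_hitting_point; defn.
  - intros A _ _; apply countable_sub with empty; [apply countable_empty|].
    intros s Hs; rewrite in_sep in Hs by (unfold small_hitting_point; defn).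
    destruct Hs as [_ (x & (f & Hf & Hf' & _) & _ & Hs)].
    destruct (function_total Hf Hs) as [y Hy]; destruct (in_empty (Hf' _ _ Hy)).
  - intros k Hk IH A HA Hmin.
    assert (N : nonempty A).
    (* The empty set hits the empty family and has size 0, which minimality at [succ k] forbids. *)
    { apply NNPP; intro N; apply (Hmin _ (empty_in_succ Hk) _ injects_empty).
      intros q Hq; destruct N; exists q; exact Hq. }
    destruct N as [q Hq].
    set (away t := sep A (fun z => ~ t ∈ z)).
    assert (Haway : forall t z, z ∈ away t <-> z ∈ A /\ ~ t ∈ z)
      by (intros; apply in_sep; defn).
    set (D t := sep X (small_hitting_point (away t) k)).
    assert (HD : forall t s, s ∈ D t <-> s ∈ X /\ small_hitting_point (away t) k s)
      by (intros; apply in_sep; unfold small_hitting_point; defn).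
    assert (DD : Def (fun e => e 1 = D (e 0))).
    { apply def_ext with (fun e => forall s, s ∈ e 1 <-> s ∈ X /\
        exists x, injects x k /\ (forall z, z ∈ A /\ ~ e 0 ∈ z -> meets x z) /\ s ∈ x);
        [|defn].
      assert (E : forall t s, s ∈ D t <-> s ∈ X /\
        exists x, injects x k /\ (forall z, z ∈ A /\ ~ t ∈ z -> meets x z) /\ s ∈ x).
      { intros t s; rewrite HD; unfold small_hitting_point, hits.
        split; intros (Hs & x & Hx & H & K); (split; [exact Hs|]); exists x;
          repeat split; trivial; intros z Hz; apply H, Haway; exact Hz. }
      intro e; split.
      - intro H; apply set_ext; intro s; rewrite H, E; reflexivity.
      - intros -> s; apply E. }
    destruct (@replacement_exists (fun t d => d = D t) q) as [F HF];
      [exact DD|congruence|].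
    apply countable_sub with (cup q (bigcup F)).
    + apply CUC_cup, CUC_bigcup; auto.
      * apply (@countable_image (fun t d => d = D t) q); auto; [|congruence].
        intros d Hd; apply HF, Hd.
      * intros d Hd; apply HF in Hd; destruct Hd as (t & Ht & ->); apply IH.
        -- intros z Hz; apply HA, (Haway t z), Hz.
        (* A hitting set of [away t] of size below [k], enlarged by [t], would hit all of [A] with
           size below [succ k]. *)
        -- intros j Hj x Hx H; apply (Hmin (succ j)) with (cup x (upair t t)).
           ++ apply succ_mem; assumption.
           ++ apply injects_cons, Hx.
           ++ intros z Hz; destruct (classic (t ∈ z)) as [Htz|Htz].
              ** exists t; rewrite in_cup, in_upair; auto.
              ** destruct (H z) as (s & Hs & Hs'); [apply Haway; auto|].
                 exists s; rewrite in_cup; auto.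
    + intros s Hs; rewrite in_sep in Hs by (unfold small_hitting_point; defn).
      destruct Hs as [HsX (x & Hx & H & Hs)]; destruct (H q Hq) as (t & Htx & Htq).
      apply in_cup; destruct (classic (s = t)) as [->|Hst]; [auto|right].
      apply in_bigcup; exists (D t); split; [apply HF; eauto|].
      apply HD; split; trivial.
      (* Without [t], the set [x] has size at most [k] and still hits every member that avoids
         [t]. *)
      exists (sep x (fun y => y <> t)); repeat split.
      * apply injects_remove; assumption.
      * intros z Hz; apply Haway in Hz; destruct Hz as [Hz Hz'].
        destruct (H z Hz) as (y & Hy & Hy'); exists y; rewrite in_sep by defn.
        repeat split; trivial; congruence.
      * rewrite in_sep by defn; auto.
Qed.

(** Stated as a relation so that Replacement can collect the sets [d]; the least size [k] depends on
    [A] alone, which makes [d] canonical. *)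
Definition minimal_hitting_points X A d : Prop :=
  exists k, least (fun k => exists x, injects x k /\ hits x A) k /\
    forall s, s ∈ d <-> s ∈ X /\ small_hitting_point A k s.

Lemma minimal_hitting_points_unique X A d d' :
  minimal_hitting_points X A d -> minimal_hitting_points X A d' -> d = d'.
Proof.
  intros (k & Hk & H) (k' & Hk' & H'); rewrite (least_unique Hk' Hk) in H'.
  apply set_ext; intro s; rewrite H, H'; reflexivity.
Qed.

Lemma minimal_hitting_points_exist X A x : CUC M ->
  (forall q, q ∈ A -> q ⊆ X /\ countable q) -> finite x -> hits x A ->
  exists d, minimal_hitting_points X A d /\ countable d /\ hits d A.
Proof.
  intros HC HA Hx Hh; destruct (injects_finite Hx) as (n & Hn & Hi).
  destruct (@least_exists (fun k => exists x, injects x k /\ hits x A) n) as [k Hk];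
    [defn|exact Hn|eauto|].
  assert (E : forall s, s ∈ sep X (small_hitting_point A k) <->
    s ∈ X /\ small_hitting_point A k s)
    by (intros; apply in_sep; unfold small_hitting_point; defn).
  exists (sep X (small_hitting_point A k)); split; [|split].
  - exists k; auto.
  - destruct Hk as (Hk & _ & L); apply countable_small_hitting_points; trivial.
    + intros q Hq; apply (HA q Hq).
    + intros j Hj y Hy Hy'; apply (L j Hj); eauto.
  - intros z Hz; destruct Hk as (_ & (y & Hy & Hy') & _).
    destruct (Hy' z Hz) as (s & Hs & Hs'); exists s; split; [|exact Hs'].
    apply E; split; [exact (proj1 (HA z Hz) s Hs')|exists y; auto].
Qed.

Lemma def_minimal_hitting_points X :
  Def (fun e => minimal_hitting_points X (e 0) (e 1)).
Proof. unfold minimal_hitting_points, small_hitting_point; defn. Qed.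

(* No choice is needed here: the points of the hitting sets of minimal size of [A] form a
   canonical countable hitting set of [A]. *)
Lemma finitely_hit_common_hitting X F : CUC M -> countable F ->
  (forall A, A ∈ F -> (forall z, z ∈ A -> z ⊆ X /\ countable z) /\
    exists x, finite x /\ hits x A) ->
  exists h, countable h /\ forall A, A ∈ F -> hits h A.
Proof.
  intros HC HF H.
  assert (E : forall A, A ∈ F ->
    exists d, minimal_hitting_points X A d /\ countable d /\ hits d A).
  { intros A HA; destruct (H A HA) as (K & x & Hx & Hx').
    apply minimal_hitting_points_exist with x; assumption. }
  pose proof (def_minimal_hitting_points X) as HD.
  destruct (@replacement_exists (minimal_hitting_points X) F) as [D HD'];
    [exact HD|intros A d d' _; apply minimal_hitting_points_unique|].
  assert (ED : forall A d, A ∈ F -> minimal_hitting_points X A d -> countable d /\ hits d A).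
  { intros A d HA Hd; destruct (E A HA) as (d' & K & L).
    rewrite (minimal_hitting_points_unique Hd K); exact L. }
  exists (bigcup D); split.
  - apply CUC_bigcup; trivial.
    + apply (@countable_image (minimal_hitting_points X) F); trivial.
      * intros d Hd; apply HD', Hd.
      * intros A d d' _ _ _; apply minimal_hitting_points_unique.
    + intros d Hd; apply HD' in Hd; destruct Hd as (A & HA & Hd); apply (ED A d HA Hd).
  - intros A HA; destruct (E A HA) as (d & Hd & _ & K).
    apply hits_sub with d; trivial; intros s Hs; apply in_bigcup; exists d; split; trivial.
    apply HD'; eauto.
Qed.

(** * From common hitting sets to the sequence principles I and II *)

Lemma common_hitting_sequence w A : common_hitting -> is_omega w -> function_on A w ->
  (forall n a, maps A n a -> (forall z, z ∈ a -> finite z) /\ exists h, countable h /\ hits h a) ->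
  exists h, countable h /\ forall n a, maps A n a -> hits h a.
Proof.
  intros HH Hw HA H; apply is_omega_iff in Hw; subst w.
  destruct (range_exists HA) as [D HD]; destruct (HH D) as (h & Hh & K).
  - exact (countable_range countable_omega HA HD).
  - intros a Ha; apply HD in Ha; destruct Ha as [n Hn]; exact (H n a Hn).
  - exists h; split; trivial; intros n a Hn; apply K, HD; eauto.
Qed.

Lemma common_hitting_PS0_I : common_hitting -> PS0_I M.
Proof.
  intros HH w X A C (_ & (Hw & HA & _) & [HC HC'] & Ha & Hc).
  destruct (common_hitting_sequence HH Hw HA) as (h & Hh & K).
  - intros n a Hn; destruct (Ha n a Hn) as [_ Hz]; split; [intros z Hzz; apply Hz, Hzz|].
    destruct (function_total HC (function_dom HA Hn)) as [c Hnc].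
    destruct (Hc n c Hnc) as [x Hx]; apply (HC' n a c Hn Hnc) in Hx.
    destruct Hx as [[_ Hx] Hx']; exists x; auto.
  (* Members of the sets [C_n] are subsets of [X]. Cutting [h] down to [X] loses no hit, since the
     families consist of subsets of [X]. *)
  - exists (sep h (fun t => t ∈ X)); intros n c Hnc.
    destruct (function_total HA (function_dom HC Hnc)) as [a Hn].
    assert (E : forall t, t ∈ sep h (fun t => t ∈ X) <-> t ∈ h /\ t ∈ X)
      by (intro; rewrite in_sep by defn; reflexivity).
    apply (HC' n a c Hn Hnc); split; [split|].
    + intros t Ht; apply E, Ht.
    + apply countable_sub with h; trivial; intros t Ht; apply E, Ht.
    + apply hits_sep; [|exact (K n a Hn)].
      intros z Hz; apply (proj2 (Ha n a Hn) z Hz).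
Qed.

(** A common element of all the [C_n] yields a constant choice function. *)
Lemma PS0_I_PS0_II : PS0_I M -> PS0_II M.
Proof.
  intros HI w X A C H D HD; destruct (HI w X A C H) as [x Hx].
  destruct (@function_exists (fun _ y => y = x) D) as (f & Hf & K);
    [defn|eauto|congruence|].
  exists f; split; [exact Hf|]; intros c y Hc; apply K in Hc; destruct Hc as [Hc ->].
  apply HD in Hc; destruct Hc as [n Hn]; exact (Hx n c Hn).
Qed.

(** * Partitions from hitting sets *)

Definition block g a n b : Prop :=
  forall z, z ∈ b <-> z ∈ a /\ least (fun m => exists s, s ∈ z /\ maps g s m) n.

(* The members of [a], sorted by their [g]-least point in the domain of [g]. *)
Definition block_partition g a Z : Prop :=
  forall b, b ∈ Z <-> nonempty b /\ exists n, block g a n b.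

Lemma def_block_partition g : Def (fun e => block_partition g (e 0) (e 1)).
Proof. unfold block_partition, block; defn. Qed.

Lemma block_partition_unique g a Z Z' :
  block_partition g a Z -> block_partition g a Z' -> Z = Z'.
Proof. intros H H'; apply set_ext; intro b; rewrite (H b), (H' b); reflexivity. Qed.

Lemma block_partition_exists g a : exists Z, block_partition g a Z.
Proof.
  exists (sep (power a) (fun b => nonempty b /\ exists n, block g a n b)); intro b.
  rewrite in_sep, in_power by (unfold block; defn); split; [tauto|].
  intros [H (n & Hn)]; repeat split; eauto; intros z Hz; apply Hn, Hz.
Qed.

(** All members of the block with number [n] share the point numbered [n] by [g], so a singleton
    hits the block. The numbers also enumerate the blocks, and [hits h a] puts every member into
    some block. *)
Lemma block_partition_correct g h a Z : injection g h omega -> hits h a ->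
  block_partition g a Z ->
  countable Z /\ partition Z a /\
  forall b, b ∈ Z -> exists U x, is_union U b /\ finite_subset x U /\ hits x b.
Proof.
  intros (Hg & Hg' & Hi) Hh HZ; split; [|split; [split; [|split]|]].
  - apply (@countable_intro (fun b n => block g a n b)).
    + unfold block; defn.
    + intros b Hb; apply HZ in Hb; destruct Hb as [[z Hz] [n Hn]]; exists n.
      split; [|exact Hn]; apply Hn in Hz; apply Hz.
    + intros b b' n _ _ H H'; apply set_ext; intro z; rewrite (H z), (H' z); reflexivity.
  - intros b Hb; apply HZ in Hb; destruct Hb as [Hb [n Hn]]; split; trivial.
    intros z Hz; apply Hn, Hz.
  - intros b b' Hb Hb' N (z & Hz & Hz'); apply HZ in Hb, Hb'; apply N.
    destruct Hb as [_ [n Hn]], Hb' as [_ [n' Hn']]; apply set_ext; intro y.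
    rewrite (Hn y), (Hn' y); apply Hn in Hz; apply Hn' in Hz'.
    rewrite (least_unique (proj2 Hz) (proj2 Hz')); reflexivity.
  - intros z Hz; destruct (Hh z Hz) as (s & Hs & Hsz).
    destruct (function_total Hg Hs) as [m Hm].
    destruct (@least_exists (fun m => exists s, s ∈ z /\ maps g s m) m) as [n Hn];
      [defn|exact (Hg' _ _ Hm)|eauto|].
    exists (sep a (fun z => least (fun m => exists s, s ∈ z /\ maps g s m) n)).
    assert (B : block g a n
      (sep a (fun z => least (fun m => exists s, s ∈ z /\ maps g s m) n)))
      by (intro; rewrite in_sep by defn; reflexivity).
    split; [apply HZ; split; [|eauto]; exists z|]; apply B; auto.
  - intros b Hb; apply HZ in Hb; destruct Hb as [[z Hz] [n Hn]].
    assert (Hz' := Hz); apply Hn in Hz'; destruct Hz' as (_ & _ & (s & Hs & Hsn) & _).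
    exists (bigcup b), (upair s s); split; [apply is_union_iff; reflexivity|].
    split; [split; [|apply finite_sing]|].
    + intros t Ht; apply in_upair in Ht; apply in_bigcup; exists z.
      destruct Ht; subst; auto.
    + intros y Hy; apply Hn in Hy; destruct Hy as (_ & _ & (s' & Hs' & Hsn') & _).
      rewrite (Hi _ _ _ Hsn' Hsn) in Hs'; exists s; rewrite in_upair; auto.
Qed.

(** Serves to recover a family from any of its partitions, and hence from the set of its admissible
    partitions when that set is non-empty. *)
Lemma partition_cover a a' Z : partition Z a -> partition Z a' -> a = a'.
Proof.
  intros (H & _ & K) (H' & _ & K'); apply set_ext; intro z; split; intro Hz.
  - destruct (K z Hz) as (b & Hb & Hzb); exact (proj2 (H' b Hb) z Hzb).
  - destruct (K' z Hz) as (b & Hb & Hzb); exact (proj2 (H b Hb) z Hzb).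
Qed.

(** The principle is used twice: on the blocks of one partition, to give each family a countable
    hitting set, and then on the whole sequence. A single enumeration of the common hitting set
    defines the chosen partitions simultaneously. *)
Lemma common_hitting_PS0_C : common_hitting -> PS0_C M.
Proof.
  intros HH w X A B (_ & (Hw & HA & _) & [HB HB'] & Ha & Hb) D HD.
  destruct (common_hitting_sequence HH Hw HA) as (h & Hh & K).
  - intros n a Hn; destruct (Ha n a Hn) as [_ Hz].
    assert (Hfin : forall z, z ∈ a -> finite z) by (intros z Hza; apply Hz, Hza).
    split; [exact Hfin|].
    destruct (function_total HB (function_dom HA Hn)) as [c Hnc].
    destruct (Hb n c Hnc) as [Z HZ]; apply (HB' n a c Hn Hnc) in HZ.
    destruct HZ as (HZc & HZp & HZb); destruct (HH Z HZc) as (h & Hh & K).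
    + intros b HbZ; destruct HZp as (HZp & _ & _); split.
      * intros z Hzb; apply Hfin, (HZp b HbZ), Hzb.
      * destruct (HZb b HbZ) as (U & x & _ & [_ Hx] & Hx'); exists x; split; trivial.
        apply countable_finite, Hx.
    + exists h; split; trivial; intros z Hza.
      destruct HZp as (_ & _ & HZp); destruct (HZp z Hza) as (b & HbZ & Hzb).
      exact (K b HbZ z Hzb).
  - destruct (countable_elim Hh) as [g Hg]; pose proof (def_block_partition g) as Hdef.
    assert (HZ : forall n a c Z, maps A n a -> maps B n c -> block_partition g a Z -> Z ∈ c).
    { intros n a c Z Hn Hnc HZ; apply (HB' n a c Hn Hnc).
      exact (block_partition_correct Hg (K n a Hn) HZ). }
    destruct (@function_exists (fun c Z => exists n a,
      maps A n a /\ maps B n c /\ block_partition g a Z) D) as (f & Hf & L).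
    + defn.
    + intros c Hc; apply HD in Hc; destruct Hc as [n Hnc].
      destruct (function_total HA (function_dom HB Hnc)) as [a Hn].
      destruct (block_partition_exists g a) as [Z HZ']; eauto 6.
    (* The same [c] may occur at several indices; the families there coincide, because each is the
       one partitioned by a member of [c]. *)
    + intros c Z Z' _ (n & a & Hn & Hnc & H) (n' & a' & Hn' & Hnc' & H').
      assert (E : a = a').
      { pose proof (HZ n a c Z Hn Hnc H) as HZc.
        apply (@partition_cover a a' Z).
        - apply (HB' n a c Hn Hnc), HZc.
        - apply (HB' n' a' c Hn' Hnc'), HZc. }
      subst a'; exact (block_partition_unique H H').
    + exists f; split; [exact Hf|]; intros c Z Hc; apply L in Hc.
      destruct Hc as [_ (n & a & Hn & Hnc & H)]; exact (HZ n a c Z Hn Hnc H).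
Qed.

(** * The spaces S(X, [X]^{≤ω}) *)

Definition space_open X V : Prop :=
  forall x, x ∈ V ->
    exists z, countable_subset z X /\ disjoint x z /\
      forall y, finite_subset y X -> x ⊆ y -> (forall t, t ∈ y -> t ∈ X /\ ~ t ∈ z) -> y ∈ V.

Lemma space_S_exists X : exists S T, is_space_S X S T.
Proof.
  set (S := sep (power X) finite).
  exists S, (sep (power S) (space_open X)); split.
  - intro x; unfold S; rewrite in_sep, in_power by defn; reflexivity.
  - intro V; rewrite in_sep, in_power by (unfold space_open; defn); reflexivity.
Qed.

Lemma PS0_common_hitting : PS0 M -> common_hitting.
Proof.
  intros HP F HF HFA; set (X := bigcup (bigcup F)).
  assert (HX : forall A z, A ∈ F -> z ∈ A -> z ⊆ X).
  { intros A z HA Hz t Ht; apply in_bigcup; exists z; split; trivial.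
    apply in_bigcup; eauto. }
  (* [PS0] speaks of uncountable sets only. A countable [X] is itself a common hitting set, since
     every member of a family that has a hitting set is non-empty. *)
  destruct (classic (countable X)) as [HXc|HXu].
  { exists X; split; trivial; intros A HA z Hz; destruct (HFA A HA) as (_ & h & _ & Hh).
    destruct (Hh z Hz) as (t & _ & Ht); exists t; split; trivial.
    exact (HX A z HA Hz t Ht). }
  destruct (space_S_exists X) as (S & T & HS); destruct (HP X HXu S T HS) as [_ HG].
  destruct HS as [HS HT].
  set (R := fun A V => forall y, y ∈ V <-> y ∈ S /\
    exists x, countable_subset x X /\ hits x A /\ disjoint y x).
  assert (RD : Def (fun e => R (e 0) (e 1))) by (unfold R; defn).
  assert (RU : forall A V V', R A V -> R A V' -> V = V').
  { intros A V V' H H'; apply set_ext; intro y; rewrite (H y), (H' y); reflexivity. }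
  assert (RE : forall A, exists V, R A V).
  { intro A; exists (sep S (fun y =>
      exists x, countable_subset x X /\ hits x A /\ disjoint y x)).
    intro y; rewrite in_sep by defn; reflexivity. }
  destruct (@replacement_exists R F) as [K HK]; [exact RD|eauto|].
  set (G := sep S (fun y => forall V, V ∈ K -> y ∈ V)).
  assert (EG : forall y, y ∈ G <-> y ∈ S /\ forall V, V ∈ K -> y ∈ V)
    by (intro y; unfold G; rewrite in_sep by defn; reflexivity).
  assert (HGT : G ∈ T).
  { apply HG; exists K; split; [|split; [|exact EG]].
    - apply (@countable_image R F); eauto; intros V HV; apply HK, HV.
    - intros V HV; apply HK in HV; destruct HV as (A & HA & HV); apply HT; split.
      + intros y Hy; apply HV in Hy; apply Hy.
      + intros y Hy; apply HV in Hy; destruct Hy as (_ & x & Hx & Hx' & Hyx).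
        (* The hitting set [x] that witnesses [y ∈ V] is also the set to be avoided: finite sets
           avoiding it lie in [V] by the same witness. *)
        exists x; split; [exact Hx|split; [exact Hyx|]].
        intros y' Hy' _ Hd; apply HV; split; [apply HS; exact Hy'|].
        exists x; split; [exact Hx|split; [exact Hx'|]].
        intros (t & Ht & Htx); exact (proj2 (Hd t Ht) Htx). }
  assert (H0 : empty ∈ G).
  { apply EG; split.
    - apply HS; split; [intros t Ht; destruct (in_empty Ht)|apply finite_empty].
    - intros V HV; apply HK in HV; destruct HV as (A & HA & HV); apply HV; split.
      + apply HS; split; [intros t Ht; destruct (in_empty Ht)|apply finite_empty].
      + destruct (HFA A HA) as (_ & h & Hh & Hh').
        exists (sep h (fun t => t ∈ X)); split; [split|split].
        * intros t Ht; rewrite in_sep in Ht by defn; apply Ht.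
        * apply countable_sub with h; trivial; intros t Ht.
          rewrite in_sep in Ht by defn; apply Ht.
        * apply hits_sep; eauto.
        * intros (t & Ht & _); destruct (in_empty Ht). }
  apply HT in HGT; destruct HGT as [_ HGT].
  destruct (HGT _ H0) as (h & [_ Hh] & _ & L); exists h; split; [exact Hh|].
  (* If [h] missed [z], then [z] would belong to the neighbourhood of the empty set given by [h],
     hence be disjoint from some hitting set of its own family. *)
  intros A HA z Hz; apply NNPP; intro N.
  assert (HzG : z ∈ G).
  { apply L.
    - split; [exact (HX A z HA Hz)|exact (proj1 (HFA A HA) z Hz)].
    - intros t Ht; destruct (in_empty Ht).
    - intros t Ht; split; [exact (HX A z HA Hz t Ht)|]; intro Hth; apply N.
      exists t; auto. }
  destruct (RE A) as [V HV]; apply EG in HzG; destruct HzG as [_ HzG].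
  assert (HzV : z ∈ V) by (apply HzG, HK; eauto).
  apply HV in HzV; destruct HzV as (_ & x & _ & Hx & Hd).
  destruct (Hx z Hz) as (t & Ht & Ht'); apply Hd; exists t; auto.
Qed.

Lemma space_topology X S T : CUC M -> is_space_S X S T -> topology S T.
Proof.
  intros HC [HS HT]; repeat split.
  - intros U HU; apply HT in HU; apply HU.
  - intros U HU; apply HT; split; intros x Hx; destruct (proj1 (HU x) Hx).
  - apply HT; split; [intros x Hx; exact Hx|]; intros x Hx; exists empty.
    split; [split; [|apply countable_empty]|split].
    + intros t Ht; destruct (in_empty Ht).
    + intros (t & _ & Ht); destruct (in_empty Ht).
    + intros y Hy _ _; apply HS; exact Hy.
  - intros U V W HU HV HW; apply HT in HU, HV; apply HT.
    destruct HU as [HU HU'], HV as [HV HV']; split.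
    + intros x Hx; apply HW in Hx; apply HU, Hx.
    + intros x Hx; apply HW in Hx; destruct Hx as [HxU HxV].
      destruct (HU' x HxU) as (z & [Hz Hzc] & Hd & K).
      destruct (HV' x HxV) as (z' & [Hz' Hzc'] & Hd' & K').
      (* Avoiding both countable sets keeps a neighbour inside both open sets. *)
      exists (cup z z'); split; [split|split].
      * intros t Ht; apply in_cup in Ht; destruct Ht; auto.
      * apply CUC_cup; assumption.
      * intros (t & Ht & Htz); apply in_cup in Htz.
        destruct Htz; [apply Hd | apply Hd']; exists t; auto.
      * intros y Hy Hxy L; apply HW; split; [apply K | apply K']; trivial;
          intros t Ht; destruct (L t Ht) as [HtX N]; rewrite in_cup in N; tauto.
  - intros F U HF HU; apply HT; split.
    + intros x Hx; apply HU in Hx; destruct Hx as (V & HV & Hx).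
      apply HF, HT in HV; apply HV, Hx.
    + intros x Hx; apply HU in Hx; destruct Hx as (V & HV & Hx).
      assert (HV' := HV); apply HF, HT in HV'; destruct HV' as [_ HV'].
      destruct (HV' x Hx) as (z & Hz & Hd & K); exists z; split; [|split]; trivial.
      intros y Hy Hxy L; apply HU; exists V; auto.
Qed.

Lemma common_hitting_PS0 : common_hitting -> PS0 M.
Proof.
  intros HH X _ S T HST; assert (HC := common_hitting_CUC HH); split.
  { exact (space_topology HC HST). }
  destruct HST as [HS HT]; intros G (F & HF & HFT & HG); apply HT; split.
  { intros x Hx; apply HG in Hx; exact (proj1 Hx). }
  intros x Hx; apply HG in Hx; destruct Hx as [HxS HxF].
  (* [R U A]: [A] consists of the differences [y \ x] for the neighbours [y] of [x] outside
     [U]; a hitting set of [A] gives a basic neighbourhood of [x] inside [U]. *)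
  set (R := fun U A => forall v, v ∈ A <-> v ∈ power X /\ exists y,
    finite_subset y X /\ x ⊆ y /\ ~ y ∈ U /\ forall t, t ∈ v <-> t ∈ y /\ ~ t ∈ x).
  assert (RD : Def (fun e => R (e 0) (e 1))) by (unfold R; defn).
  assert (RU : forall U A A', R U A -> R U A' -> A = A').
  { intros U A A' H H'; apply set_ext; intro v; rewrite (H v), (H' v); reflexivity. }
  assert (RE : forall U, exists A, R U A).
  { intro U; exists (sep (power X) (fun v => exists y,
      finite_subset y X /\ x ⊆ y /\ ~ y ∈ U /\ forall t, t ∈ v <-> t ∈ y /\ ~ t ∈ x)).
    intro y; rewrite in_sep by defn; reflexivity. }
  destruct (@replacement_exists R F) as [K HK]; [exact RD|eauto|].
  destruct (HH K) as (h & Hh & L).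
  - apply (@countable_image R F); eauto; intros A HA; apply HK, HA.
  - intros A HA; apply HK in HA; destruct HA as (U & HU & HA); split.
    + intros v Hv; apply HA in Hv; destruct Hv as (_ & y & [_ Hy] & _ & _ & Hv).
      apply finite_sub with y; trivial; intros t Ht; apply Hv, Ht.
    + assert (HU' := HFT U HU); apply HT in HU'; destruct HU' as [_ HU'].
      destruct (HU' x (HxF U HU)) as (z & [_ Hz] & Hd & N); exists z; split; trivial.
      intros v Hv; apply HA in Hv; destruct Hv as (_ & y & Hy & Hxy & HyU & Hv).
      (* If [z] missed [v], then [y] would avoid [z]: its points in [x] do so because [x] and [z]
         are disjoint, the others because they lie in [v]. This would put [y] into [U]. *)
      apply NNPP; intro Q; apply HyU, N; trivial; intros t Ht; split.
      * apply Hy, Ht.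
      * intro Htz; destruct (classic (t ∈ x)) as [Htx|Htx].
        -- apply Hd; exists t; auto.
        -- apply Q; exists t; split; trivial; apply Hv; auto.
  - assert (E : forall t, t ∈ sep h (fun t => t ∈ X /\ ~ t ∈ x) <-> t ∈ h /\ t ∈ X /\ ~ t ∈ x)
      by (intro; rewrite in_sep by defn; reflexivity).
    (* The set to be avoided must be disjoint from [x], so the points of [x] are dropped from [h];
       the differences [y \ x] are still hit, as they contain none of them. *)
    exists (sep h (fun t => t ∈ X /\ ~ t ∈ x)); split; [split|split].
    + intros t Ht; apply E in Ht; apply Ht.
    + apply countable_sub with h; trivial; intros t Ht; apply E in Ht; apply Ht.
    + intros (t & Ht & Ht'); apply E in Ht'; tauto.
    + intros y Hy Hxy N; apply HG; split; [apply HS; exact Hy|].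
      intros U HU; apply NNPP; intro HyU; destruct (RE U) as [A HA].
      assert (HAK : A ∈ K) by (apply HK; eauto).
      set (v := sep y (fun t => ~ t ∈ x)).
      assert (Ev : forall t, t ∈ v <-> t ∈ y /\ ~ t ∈ x)
        by (intro; unfold v; rewrite in_sep by defn; reflexivity).
      destruct (L A HAK v) as (t & Ht & Htv).
      * apply HA; split; [|exists y; auto].
        apply in_power; intros t Ht; apply Hy; apply Ev, Ht.
      * apply Ev in Htv; destruct Htv as [Hty Htx]; destruct (N t Hty) as [HtX Q].
        apply Q, E; auto.
Qed.

(** * Reduction to sequences of families *)

(* Adding to [X] the new points [{X, n}], which are not in [X] by foundation, and to the
   [n]-th family all pairs [{{X, n}, s}] makes every family uncountable and the sequence
   injective, while [{X, n}] hits all the added pairs. *)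
Lemma common_hitting_of_sequences :
  (forall w X A, uncountable X -> denumerable_family w A ->
    (forall n a, maps A n a -> uncountable a /\
      (forall z, z ∈ a -> finite_subset z X /\ nonempty z) /\
      exists h, countable_subset h X /\ hits h a) ->
    exists h, countable h /\ forall n a, maps A n a -> hits h a) ->
  common_hitting.
Proof.
  intros HQ F HF HFA; set (X := bigcup (bigcup F)).
  assert (HX : forall A z, A ∈ F -> z ∈ A -> z ⊆ X).
  { intros A z HA Hz t Ht; apply in_bigcup; exists z; split; trivial.
    apply in_bigcup; eauto. }
  destruct (classic (countable X)) as [HXc|HXu].
  { exists X; split; trivial; intros A HA z Hz; destruct (HFA A HA) as (_ & h & _ & Hh).
    destruct (Hh z Hz) as (t & _ & Ht); exists t; split; trivial.
    exact (HX A z HA Hz t Ht). }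
  assert (new : forall n, ~ upair X n ∈ X).
  { intros n H; apply (mem_asym H), in_upair; auto. }
  destruct (countable_elim HF) as (f & Hf & Hf' & Hi).
  destruct (@replacement_exists (fun n t => t = upair X n) omega) as [N HN];
    [defn|congruence|].
  set (Y := cup X N).
  assert (HXY : X ⊆ Y) by (intros t Ht; apply in_cup; auto).
  assert (HNY : forall n, n ∈ omega -> upair X n ∈ Y)
    by (intros n Hn; apply in_cup; right; apply HN; eauto).
  (* The number of a family under [f] becomes its index; an index that [f] does not take carries
     only the added pairs. *)
  set (R := fun n a => forall v, v ∈ a <->
    (exists D, maps f D n /\ v ∈ D) \/ exists s, s ∈ X /\ v = upair (upair X n) s).
  assert (RD : Def (fun e => R (e 0) (e 1))) by (unfold R; defn).
  assert (RU : forall n a a', R n a -> R n a' -> a = a').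
  { intros n a a' H H'; apply set_ext; intro v; rewrite (H v), (H' v); reflexivity. }
  assert (RE : forall n, n ∈ omega -> exists a, R n a).
  { intros n Hn; exists (sep (power Y) (fun v =>
      (exists D, maps f D n /\ v ∈ D) \/ exists s, s ∈ X /\ v = upair (upair X n) s)).
    intro v; rewrite in_sep, in_power by defn; split; [tauto|].
    intro H; split; trivial; intros t Ht; destruct H as [(D & HD & Hv)|(s & Hs & ->)].
    - apply HXY, (HX D v); trivial; exact (function_dom Hf HD).
    - apply in_upair in Ht; destruct Ht; subst; auto. }
  (* The point [{X, n}] belongs to no member of a family in [F], and among the added pairs only to
     those of index [n], so the enlarged family determines [n]. *)
  assert (RI : forall n n' a, R n a -> R n' a -> n = n').
  { intros n n' a H H'.
    assert (HXn : nonempty X).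
    { apply NNPP; intro Q; apply HXu, countable_sub with empty; [apply countable_empty|].
      intros t Ht; destruct Q; exists t; exact Ht. }
    destruct HXn as [s Hs].
    assert (Hv : upair (upair X n) s ∈ a) by (apply H; eauto).
    assert (Hn : upair X n ∈ upair (upair X n) s) by (apply in_upair; auto).
    apply H' in Hv; destruct Hv as [(D & HD & Hv)|(s' & Hs' & E)].
    - destruct (@new n); apply (HX D _ (function_dom Hf HD) Hv), Hn.
    - rewrite E in Hn; apply in_upair in Hn; destruct Hn as [Hn|Hn].
      + exact (upair_inj Hn).
      + destruct (@new n); congruence. }
  destruct (function_exists RD RE) as (A & HA & HAR); [eauto|].
  destruct (range_exists HA) as [C HC].
  destruct (HQ omega Y A) as (h & Hh & L).
  - intro H; apply HXu, countable_sub with Y; assumption.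
  - split; [apply is_omega_iff; reflexivity|]; split; [exact HA|]; exists C; split; trivial.
    exists omega; split; [apply is_omega_iff; reflexivity|].
    destruct (@injects_intro (fun a n => maps A n a) C omega) as (g & Hg & K).
    + defn.
    + intros a Ha; apply HC, Ha.
    + intros a n n' _ H H'; apply HAR in H, H'; apply (RI n n' a); tauto.
    + intros a n _ H; apply HAR in H; apply H.
    + intros a a' n _ _ H H'; exact (function_unique HA H H').
    + exists g; split; trivial; intro n; split.
      * intro Hn; destruct (function_total HA Hn) as [a Ha]; exists a; apply K.
        split; trivial; apply HC; eauto.
      * intros [a Ha]; apply K in Ha; destruct Ha as [_ Ha]; exact (function_dom HA Ha).
  - intros n a Hn; apply HAR in Hn; destruct Hn as [Hn Ha]; split; [|split].
    (* The pairs added at index [n] are in one-to-one correspondence with the points of [X]. *)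
    + intro Hac; apply HXu.
      apply (@countable_image (fun v s => v = upair (upair X n) s) a); trivial.
      * defn.
      * intros s Hs; exists (upair (upair X n) s); split; trivial; apply Ha; eauto.
      * intros v s s' _ _ _ -> H; exact (upair_inj H).
    + intros v Hv; apply Ha in Hv; destruct Hv as [(D & HD & Hv)|(s & Hs & ->)].
      * apply (function_dom Hf) in HD; destruct (HFA D HD) as (Hfin & h & _ & Hh).
        split; [split; [|auto]|].
        -- intros t Ht; exact (HXY t (HX D v HD Hv t Ht)).
        -- destruct (Hh v Hv) as (t & _ & Ht); exists t; exact Ht.
      * split; [split; [|apply finite_upair]|].
        -- intros t Ht; apply in_upair in Ht; destruct Ht; subst; auto.
        -- exists s; apply in_upair; auto.
    + assert (Hh : exists h, countable h /\ forall D, maps f D n -> hits h D).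
      { destruct (classic (exists D, maps f D n)) as [[D HD]|Q].
        - destruct (HFA D (function_dom Hf HD)) as (_ & h & Hh & Hh'); exists h.
          split; trivial; intros D' HD'; rewrite (Hi _ _ _ HD' HD); exact Hh'.
        - exists empty; split; [apply countable_empty|]; intros D HD; destruct Q; eauto. }
      destruct Hh as (h & Hh & Hh').
      assert (E : forall t, t ∈ sep h (fun t => t ∈ X) <-> t ∈ h /\ t ∈ X)
        by (intro; rewrite in_sep by defn; reflexivity).
      exists (cup (sep h (fun t => t ∈ X)) (upair (upair X n) (upair X n))).
      split; [split|].
      * intros t Ht; apply in_cup in Ht; rewrite E, in_upair in Ht.
        destruct Ht as [[_ Ht]|[-> | ->]]; auto.
      * apply countable_cons, countable_sub with h; trivial; intros t Ht; apply E, Ht.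
      * intros v Hv; apply Ha in Hv; destruct Hv as [(D & HD & Hv)|(s & Hs & ->)].
        -- destruct (Hh' D HD v Hv) as (t & Ht & Htv); exists t; split; trivial.
           apply in_cup; left; apply E; split; trivial.
           exact (HX D v (function_dom Hf HD) Hv t Htv).
        -- exists (upair X n); rewrite in_cup, !in_upair; auto.
  - exists h; split; trivial; intros D HD z Hz.
    destruct (function_total Hf HD) as [n Hn]; destruct (RE n (Hf' _ _ Hn)) as [a Ha].
    apply (L n a); [apply HAR; split; trivial; exact (Hf' _ _ Hn)|apply Ha; eauto].
Qed.

(** * From the sequence principles back to common hitting sets *)

Lemma C_sequence_exists w X A : function_on A w -> exists C, C_sequence w X A C.
Proof.
  intro HA.
  destruct (@function_exists (fun n c => exists a, maps A n a /\ is_C X a c) w)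
    as (C & HC & K).
  - unfold is_C; defn.
  - intros n Hn; destruct (function_total HA Hn) as [a Ha].
    exists (sep (power X) (fun x => countable x /\ forall z, z ∈ a -> meets x z)), a.
    split; trivial; intro x; rewrite in_sep, in_power by defn.
    unfold countable_subset; tauto.
  - intros n c c' _ (a & Ha & H) (a' & Ha' & H').
    rewrite (function_unique HA Ha' Ha) in H'.
    apply set_ext; intro x; rewrite (H x), (H' x); reflexivity.
  - exists C; split; [exact HC|]; intros n a c Ha Hc; apply K in Hc.
    destruct Hc as (_ & a' & Ha' & H); rewrite (function_unique HA Ha Ha'); exact H.
Qed.

Lemma B_sequence_exists w A : function_on A w -> exists B, B_sequence w A B.
Proof.
  intro HA.
  destruct (@function_exists (fun n c => exists a, maps A n a /\ is_B a c) w)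
    as (B & HB & K).
  - unfold is_B, partition; defn.
  - intros n Hn; destruct (function_total HA Hn) as [a Ha].
    set (Q := fun Z => countable Z /\ partition Z a /\ forall b, b ∈ Z ->
      exists U x, is_union U b /\ finite_subset x U /\ forall z, z ∈ b -> meets x z).
    exists (sep (power (power a)) Q), a.
    split; trivial; intro Z; rewrite in_sep, in_power by (unfold Q, partition; defn).
    unfold Q; split; [tauto|]; intro H; split; [|exact H].
    intros b Hb; apply in_power; apply H, Hb.
  - intros n c c' _ (a & Ha & H) (a' & Ha' & H').
    rewrite (function_unique HA Ha' Ha) in H'.
    apply set_ext; intro x; rewrite (H x), (H' x); reflexivity.
  - exists B; split; [exact HB|]; intros n a c Ha Hc; apply K in Hc.
    destruct Hc as (_ & a' & Ha' & H); rewrite (function_unique HA Ha Ha'); exact H.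
Qed.

Lemma uncountable_nonempty A : uncountable A -> nonempty A.
Proof.
  intro H; apply NNPP; intro N; apply H, countable_sub with empty; [apply countable_empty|].
  intros t Ht; destruct N; exists t; exact Ht.
Qed.

Lemma PS0_I_common_hitting : PS0_I M -> common_hitting.
Proof.
  intro HI; apply common_hitting_of_sequences; intros w X A HX HA Ha.
  pose proof HA as (Hw & HAw & _).
  destruct (C_sequence_exists X HAw) as [C HC]; pose proof HC as [HC1 HC2].
  destruct (HI w X A C) as [x Hx].
  { split; [exact HX|split; [exact HA|split; [exact HC|split]]].
    - intros n a Hn; destruct (Ha n a Hn) as (Hu & Hz & _).
      split; [exact (uncountable_nonempty Hu)|exact Hz].
    - intros n c Hc; destruct (function_total HAw (function_dom HC1 Hc)) as [a Hn].
      destruct (Ha n a Hn) as (_ & _ & h & Hh); exists h; apply (HC2 n a c); trivial. }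
  assert (K : forall n a, maps A n a -> countable_subset x X /\ hits x a).
  { intros n a Hn; destruct (function_total HC1 (function_dom HAw Hn)) as [c Hc].
    apply (HC2 n a c Hn Hc), (Hx n c Hc). }
  exists x; split; [|intros n a Hn; apply (K n a Hn)].
  (* Countability of the common element [x] is read off at index 0. *)
  destruct (function_total HAw (x := empty)) as [a Hn];
    [apply is_omega_iff in Hw; subst; apply omega_empty|].
  apply (K _ a Hn).
Qed.

Lemma choice_common_hitting : CUC M -> PS0_II M -> common_hitting.
Proof.
  intros HC HII; apply common_hitting_of_sequences; intros w X A HX HA Ha.
  pose proof HA as (Hw & HAw & _).
  destruct (C_sequence_exists X HAw) as [C HCs]; pose proof HCs as [HC1 HC2].
  destruct (range_exists HC1) as [D HD].
  destruct (HII w X A C) with (R := D) as (f & Hf & Hfc); trivial.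
  { split; [exact HX|split; [exact HA|split; [exact HCs|split]]].
    - intros n a Hn; destruct (Ha n a Hn) as (Hu & Hz & _).
      split; [exact (uncountable_nonempty Hu)|exact Hz].
    - intros n c Hc; destruct (function_total HAw (function_dom HC1 Hc)) as [a Hn].
      destruct (Ha n a Hn) as (_ & _ & h & Hh); exists h; apply (HC2 n a c); trivial. }
  destruct (range_exists Hf) as [K HK].
  assert (Hval : forall y, y ∈ K -> exists n a c,
    maps A n a /\ maps C n c /\ maps f c y /\ is_C X a c).
  { intros y Hy; apply HK in Hy; destruct Hy as [c Hc].
    assert (HcD := function_dom Hf Hc); apply HD in HcD; destruct HcD as [n Hn].
    destruct (function_total HAw (function_dom HC1 Hn)) as [a Hna].
    exists n, a, c; repeat split; trivial; apply (HC2 n a c); trivial. }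
  exists (bigcup K); split.
  - apply CUC_bigcup; trivial.
    + apply (@countable_range f D); trivial; apply (@countable_range C w); trivial.
      apply is_omega_iff in Hw; subst; apply countable_omega.
    + intros y Hy; destruct (Hval y Hy) as (n & a & c & _ & _ & Hc & Hcc).
      apply Hfc, Hcc in Hc; apply Hc.
  - intros n a Hn; destruct (function_total HC1 (function_dom HAw Hn)) as [c Hc].
    destruct (function_total Hf (x := c)) as [y Hy]; [apply HD; eauto|].
    apply hits_sub with y.
    + intros t Ht; apply in_bigcup; exists y; split; trivial; apply HK; eauto.
    + apply Hfc, (HC2 n a c Hn Hc) in Hy; exact (proj2 Hy).
Qed.

Lemma choice_partitions_common_hitting : CUC M -> PS0_C M -> common_hitting.
Proof.
  intros HC HPC; apply common_hitting_of_sequences; intros w X A HX HA Ha.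
  pose proof HA as (Hw & HAw & _).
  destruct (B_sequence_exists HAw) as [B HBs]; pose proof HBs as [HB1 HB2].
  destruct (range_exists HB1) as [D HD].
  destruct (HPC w X A B) with (R := D) as (f & Hf & Hfc); trivial.
  { split; [exact HX|split; [exact HA|split; [exact HBs|split]]].
    - intros n a Hn; destruct (Ha n a Hn) as (Hu & Hz & _); split; assumption.
    - intros n c Hc; destruct (function_total HAw (function_dom HB1 Hc)) as [a Hn].
      destruct (Ha n a Hn) as (_ & _ & h & [_ Hh] & Hh').
      (* An enumerated hitting set of [a] provides an admissible partition, so the choice principle
         applies. *)
      destruct (countable_elim Hh) as [g Hg]; destruct (block_partition_exists g a) as [Z HZ].
      exists Z; apply (HB2 n a c); trivial; exact (block_partition_correct Hg Hh' HZ). }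
  destruct (range_exists Hf) as [K HK].
  assert (Hval : forall Z, Z ∈ K -> exists n a, maps A n a /\ countable Z /\ partition Z a /\
    forall b, b ∈ Z -> exists U x, is_union U b /\ finite_subset x U /\ hits x b).
  { intros Z HZ; apply HK in HZ; destruct HZ as [c Hc].
    assert (HcD := function_dom Hf Hc); apply HD in HcD; destruct HcD as [n Hn].
    destruct (function_total HAw (function_dom HB1 Hn)) as [a Hna].
    exists n, a; split; trivial; apply (HB2 n a c), Hfc; assumption. }
  (* By [CUC] the blocks of all chosen partitions form one countable family; the canonical hitting
     sets of the blocks then need no further choice. *)
  destruct (@finitely_hit_common_hitting X (bigcup K)) as (h & Hh & L); trivial.
  - apply CUC_bigcup; trivial.
    + apply (@countable_range f D); trivial; apply (@countable_range B w); trivial.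
      apply is_omega_iff in Hw; subst; apply countable_omega.
    + intros Z HZ; destruct (Hval Z HZ) as (n & a & _ & Hc & _); exact Hc.
  - intros b Hb; apply in_bigcup in Hb; destruct Hb as (Z & HZ & Hb).
    destruct (Hval Z HZ) as (n & a & Hn & _ & [Hp _] & Hz); split.
    + intros z Hzb; destruct (Ha n a Hn) as (_ & Hfin & _).
      destruct (Hfin z) as [[Hs Hfz] _]; [exact (proj2 (Hp b Hb) z Hzb)|].
      split; [exact Hs|exact (countable_finite Hfz)].
    + destruct (Hz b Hb) as (U & x & _ & [_ Hx] & Hx'); exists x; auto.
  - exists h; split; trivial; intros n a Hn z Hz.
    destruct (function_total HB1 (function_dom HAw Hn)) as [c Hc].
    destruct (function_total Hf (x := c)) as [Z HZ]; [apply HD; eauto|].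
    assert (HZB := Hfc c Z HZ); apply (HB2 n a c Hn Hc) in HZB.
    destruct HZB as (_ & (_ & _ & Hp) & _); destruct (Hp z Hz) as (b & Hb & Hzb).
    apply (L b); trivial; apply in_bigcup; exists Z; split; trivial; apply HK; eauto.
Qed.

End SetTheory.

Theorem theorem7p9 (M : set_structure) (HM : ZF M) :
  (PS0 M <-> PS0_I M) /\
  (PS0 M <-> CUC M /\ PS0_II M) /\
  (PS0 M <-> CUC M /\ PS0_C M).
Proof.
  (* Replacing [PS0] by the hitting principle leaves equivalences with that principle only. *)
  assert (HI : PS0 M <-> @common_hitting M)
    by (split; [exact (PS0_common_hitting HM) | exact (common_hitting_PS0 HM)]).
  rewrite HI; split; [split|split; split].
  - exact (common_hitting_PS0_I HM).
  - exact (PS0_I_common_hitting HM).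
  - intro H; exact (conj (common_hitting_CUC HM H) (PS0_I_PS0_II HM (common_hitting_PS0_I HM H))).
  - intros [HC HII]; exact (choice_common_hitting HM HC HII).
  - intro H; exact (conj (common_hitting_CUC HM H) (common_hitting_PS0_C HM H)).
  - intros [HC HPC]; exact (choice_partitions_common_hitting HM HC HPC).
Qed.
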